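(* Let $(\mathcal X,\rho)$ be a Polish space, $p\ge1$, and $\mu\in P_p(\mathcal X)$. Let $(X_i)_{i\ge1}$ be i.i.d. with law $\mu$ and $L_n=\frac1n\sum_{i=1}^n\delta_{X_i}$. Then for all $t>0$, \[\liminf_{n\to\infty}\frac1n\log\mathbb P\big(W_p(L_n,\mu)>t\big)\ge-\inf\{H(\nu\,|\,\mu):\nu\in P_p(\mathcal X),\ W_p(\nu,\mu)>t\}.\]
   Context: $P_p(\mathcal X)$ is the set of Borel probability measures $\nu$ on $\mathcal X$ with $\int\rho(x_o,x)^p\,d\nu(x)<\infty$ for some $x_o$. $\mathcal T_p(\nu_1,\nu_2)=\inf_\pi\int\rho(x,y)^p\,d\pi$ over couplings $\pi$ of $\nu_1,\nu_2$, and $W_p=\mathcal T_p^{1/p}$. $H(\nu\,|\,\mu)=\int\log\frac{d\nu}{d\mu}\,d\nu$ if $\nu\ll\mu$, $+\infty$ otherwise. *)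

(* Defs.v *)
From HB Require Import structures.
From mathcomp Require Import all_boot all_order all_algebra.
From mathcomp Require Import all_classical all_reals all_analysis.
Set Implicit Arguments. Unset Strict Implicit. Unset Printing Implicit Defensive.
Import Order.TTheory GRing.Theory Num.Theory.
Local Open Scope classical_set_scope.
Local Open Scope ring_scope.

Definition is_metric {R : realType} {T : Type} (rho : T -> T -> R) : Prop :=
  (forall x y, 0 <= rho x y) /\
  (forall x y, rho x y = 0 <-> x = y) /\
  (forall x y, rho x y = rho y x) /\
  (forall x y z, rho x z <= rho x y + rho y z).

Definition rho_open {R : realType} {T : Type} (rho : T -> T -> R) (U : set T) : Prop :=
  forall x, U x -> exists2 e : R, 0 < e & [set y | rho x y < e] `<=` U.

Definition rho_complete {R : realType} {T : Type} (rho : T -> T -> R) : Prop :=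
  forall u : nat -> T,
    (forall e : R, 0 < e -> exists N, forall m n, (N <= m)%N -> (N <= n)%N ->
        rho (u m) (u n) < e) ->
    exists x, forall e : R, 0 < e -> exists N, forall n, (N <= n)%N -> rho (u n) x < e.

Definition rho_separable {R : realType} {T : Type} (rho : T -> T -> R) : Prop :=
  exists D : set T, countable D /\
    forall x (e : R), 0 < e -> exists2 y, D y & rho x y < e.

Definition polish_borel {d} {R : realType} (T : measurableType d) (rho : T -> T -> R) : Prop :=
  [/\ is_metric rho, rho_complete rho, rho_separable rho &
      (@measurable d T) = <<s rho_open rho >>].

Definition finite_pmoment {d} {R : realType} {T : measurableType d}
    (rho : T -> T -> R) (p : R) (nu : set T -> \bar R) : Prop :=
  exists xo : T, (\int[nu]_x ((rho xo x) `^ p)%:E < +oo)%E.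

Definition Pp {d} {R : realType} {T : measurableType d}
    (rho : T -> T -> R) (p : R) : set (probability T R) :=
  [set nu | finite_pmoment rho p nu].

Definition couplings {d} {R : realType} {T : measurableType d}
    (nu1 nu2 : set T -> \bar R) : set (probability (T * T)%type R) :=
  [set pi | forall A : set T, measurable A ->
      pi (A `*` setT) = nu1 A /\ pi (setT `*` A) = nu2 A].

Definition Tcost {d} {R : realType} {T : measurableType d}
    (rho : T -> T -> R) (p : R) (nu1 nu2 : set T -> \bar R) : \bar R :=
  ereal_inf [set (\int[pi]_z ((rho z.1 z.2) `^ p)%:E)%E | pi in couplings nu1 nu2].

Definition Wdist {d} {R : realType} {T : measurableType d}
    (rho : T -> T -> R) (p : R) (nu1 nu2 : set T -> \bar R) : \bar R :=
  poweR (Tcost rho p nu1 nu2) p^-1.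

Definition density_of {d} {R : realType} {T : measurableType d}
    (nu mu : set T -> \bar R) (f : T -> R) : Prop :=
  [/\ measurable_fun setT f, (forall x, 0 <= f x) &
      forall A, measurable A -> nu A = (\int[mu]_(x in A) (f x)%:E)%E].

(* H(nu | mu) = int log(dnu/dmu) dnu if nu << mu, +oo otherwise.
   (All densities agree mu-a.e., hence nu-a.e., so the infimum below is
   over a set with a single value whenever nu << mu.) *)
Definition rel_entropy {d} {R : realType} {T : measurableType d}
    (nu mu : set T -> \bar R) : \bar R :=
  if `[< null_dominates mu nu >] then
    ereal_inf [set (\int[nu]_x (ln (f x))%:E)%E | f in density_of nu mu]
  else +oo%E.

Definition iid_law {dO d} {R : realType} {Omega : measurableType dO}
    {T : measurableType d} (P : probability Omega R) (X : nat -> Omega -> T)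
    (mu : set T -> \bar R) : Prop :=
  [/\ (forall i, measurable_fun setT (X i)),
      (forall i A, measurable A -> P (X i @^-1` A) = mu A) &
      (forall (s : seq nat) (A : nat -> set T), uniq s ->
         (forall i, measurable (A i)) ->
         P (\big[setI/setT]_(i <- s) (X i @^-1` A i)) =
         (\prod_(i <- s) P (X i @^-1` A i))%E)].

Definition empirical {dO d} {R : realType} {Omega : measurableType dO}
    {T : measurableType d} (X : nat -> Omega -> T) (n : nat) (w : Omega) :
    set T -> \bar R :=
  fun A => ((n%:R^-1)%:E * \sum_(i < n) \d_(X i w) A)%E.

(* Main.v *)
(** Change of measure. Let [nu] have density [f] with respect to [mu] and satisfy
[W_p(nu, mu) > t], and let [Q] be [P] weighted by [F = \prod_(i < n) f (X_i)], so that
[X_0, ..., X_(n-1)] are i.i.d. with law [nu] under [Q]. Since [L_n] tends to [nu] in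
transport cost, the event [A = {W_p(L_n, mu) > t}] has [Q]-probability close to [1].
Integrating [F (1 + c 1_A - ln F) <= e^c 1_A + 1] gives [c Q(A) - n H(nu | mu) <= e^c P(A)],
and [c = n (H(nu | mu) + eps)] yields [P(A) >= e^(-c)] for large [n]; no law of large numbers
for [ln f] is needed.

Both the measurability of [A] and the passage from [nu] to [L_n] rest on one gluing estimate:
for [s > 0], [T_p(nu, mu) <= (1 + s)^p T_p(L, mu) + (1 + 1/s)^p C], where [L] is a uniform
measure on [n] points and [C] the cost of any transport plan from [nu] to [L]. Gluing through
an atomic measure needs no disintegration theorem. The plan from [nu] to [L_n] comes from a
finite partition into cells of small diameter and one cell of small [p]-th moment; the cell
frequencies are controlled by a Chernoff bound and the moment by Markov's inequality. *)

Require Import Defs.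
From HB Require Import structures.
From mathcomp Require Import all_boot all_order all_algebra.
From mathcomp Require Import all_classical all_reals all_analysis.
From mathcomp Require Import measurable_realfun ring lra.
Import Order.TTheory GRing.Theory Num.Theory.
Import numFieldNormedType.Exports.
Local Open Scope classical_set_scope.
Local Open Scope ring_scope.

Set Implicit Arguments.
Unset Strict Implicit.
Unset Printing Implicit Defensive.

(** * Images of weighted measures *)

Section weighted_law.
Local Open Scope ereal_scope.
Context {R : realType} {dO d : measure_display} {Omega : measurableType dO}
  {T : measurableType d} (P : {measure set Omega -> \bar R})
  (G : Omega -> R) (Y : Omega -> T).
Hypotheses (G0 : forall w, (0 <= G w)%R) (mG : measurable_fun setT G)
  (mY : measurable_fun setT Y).
Import HBNNSimple.

(** The image under [Y] of the measure [G dP]. With [Y = id] it is a change of density; with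
    [Y = snd] and [G] carried by a slice it is a conditional law. *)
Definition weighted_law (A : set T) : \bar R := \int[P]_(w in Y @^-1` A) (G w)%:E.

Let wl0 : weighted_law set0 = 0.
Proof. by rewrite /weighted_law preimage_set0 integral_set0. Qed.

Let wl_ge0 A : 0 <= weighted_law A.
Proof. by apply: integral_ge0 => w _; rewrite lee_fin. Qed.

Let wl_sadd : semi_sigma_additive weighted_law.
Proof.
move=> F mF tF mUF; rewrite /weighted_law preimage_bigcup ge0_integral_bigcup//=.
- by apply: is_cvg_ereal_nneg_natsum => n _; exact: wl_ge0.
- by move=> k; rewrite -[X in measurable X]setTI; exact: mY.
- by apply/measurable_EFinP; exact: measurable_funTS.
- by move=> w _; rewrite lee_fin.
- apply/trivIsetP => i j _ _ ij; rewrite -preimage_setI.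
  by move/trivIsetP : tF => /(_ i j I I ij) ->; rewrite preimage_set0.
Qed.

HB.instance Definition _ := isMeasure.Build _ _ _ weighted_law wl0 wl_ge0 wl_sadd.

Lemma weighted_lawE A : weighted_law A = \int[P]_w (G w * \1_A (Y w))%:E.
Proof.
rewrite /weighted_law integral_mkcond; apply: eq_integral => w _.
by rewrite epatch_indic EFinM.
Qed.

(** Both sides are monotone limits along simple approximations of [g], and on a level set of a
    simple function the claim is the hypothesis. Since [m] enters only through its values on
    measurable sets, it can be any measure with these values, such as a multiple of [mu]. *)
Lemma integral_of_weighted_law (m : {measure set T -> \bar R}) (g : T -> R) :
  (forall A, measurable A -> m A = \int[P]_w (G w * \1_A (Y w))%:E) ->
  (forall x, (0 <= g x)%R) -> measurable_fun setT g ->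
  \int[m]_x (g x)%:E = \int[P]_w (G w * g (Y w))%:E.
Proof.
move=> mE g0 mg.
have mg' : measurable_fun setT (EFin \o g) by exact/measurable_EFinP.
have g0' x : setT x -> 0 <= (EFin \o g) x by move=> _; rewrite lee_fin.
pose h := nnsfun_approx measurableT mg'.
have -> : \int[m]_x (g x)%:E = limn (fun n => \int[m]_x (h n x)%:E).
  rewrite -monotone_convergence//=.
  - by apply: eq_integral => x _; apply/esym/cvg_lim => //; exact: cvg_nnsfun_approx.
  - by move=> n; exact/measurable_EFinP.
  - by move=> n x _; rewrite lee_fin.
  - by move=> x _ a b ab; rewrite lee_fin; exact/lefP/nd_nnsfun_approx.
have mhY n : measurable_fun setT (fun w => G w * h n (Y w))%R.
  by apply: measurable_funM => //; apply: measurableT_comp.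
have -> : \int[P]_w (G w * g (Y w))%:E =
    limn (fun n => \int[P]_w (G w * h n (Y w))%:E).
  rewrite -monotone_convergence//=.
  - apply: eq_integral => w _; apply/esym/cvg_lim => //.
    rewrite EFinM; under eq_fun do rewrite EFinM.
    by apply: cvgeZl => //; exact: cvg_nnsfun_approx.
  - by move=> n; exact/measurable_EFinP.
  - by move=> n x _; rewrite lee_fin mulr_ge0.
  - move=> x _ a b ab; rewrite lee_fin ler_wpM2l//; exact/lefP/nd_nnsfun_approx.
congr (limn _); apply/funext => n.
have mind r : measurable_fun setT (fun w => (G w * (r * \1_(h n @^-1` [set r]) (Y w)))%:E).
  apply/measurable_EFinP/measurable_funM => //; apply: measurable_funM => //.
  by apply: measurableT_comp => //.
have ind0 r w : 0 <= (G w * (r * \1_(h n @^-1` [set r]) (Y w)))%:E.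
  by rewrite EFinM mule_ge0 ?lee_fin//; have := nnfun_muleindic_ge0 (h n) r (Y w); rewrite lee_fin.
transitivity (\int[m]_x (\sum_(y \in range (h n)) (y * \1_(h n @^-1` [set y]) x)%:E)).
  by apply: eq_integral => t tE; rewrite /= fimfunE -fsumEFin.
rewrite ge0_integral_fsum//; last 2 first.
  - move=> r; apply: measurable_funTS; apply/measurable_EFinP.
    by apply: measurable_funM.
  - by move=> *; exact: nnfun_muleindic_ge0.
transitivity (\int[P]_w (\sum_(y \in range (h n))
    (G w * (y * \1_(h n @^-1` [set y]) (Y w)))%:E)); last first.
  apply: eq_integral => w _; rewrite fimfunE fsumEFin//; congr EFin.
  by rewrite mulr_fsumr.
rewrite ge0_integral_fsum//.
apply: eq_fsbigr => r _.
have mA : measurable (h n @^-1` [set r]) by [].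
rewrite integralZl_indic_nnsfun// integral_indic// setIT mE//.
(* The scalar is moved into the integral for [r >= 0]; a negative [r] has an empty level set. *)
have [r0|r0] := leP 0%R r.
  rewrite -ge0_integralZl//.
  - by apply: eq_integral => w _; rewrite -EFinM; congr EFin; ring.
  - apply/measurable_EFinP/measurable_funM => //; apply: measurableT_comp => //.
  - by move=> w _; rewrite lee_fin mulr_ge0.
rewrite preimage_nnfun0//.
by under eq_integral do rewrite indic0 mulr0; rewrite integral0 mule0 integral0_eq// => w _; rewrite indic0 !mulr0.
Qed.

Lemma weighted_law_probability : \int[P]_w (G w)%:E = 1 ->
  exists Q : probability T R,
    (forall A, measurable A -> Q A = \int[P]_w (G w * \1_A (Y w))%:E) /\
    (forall g : T -> R, (forall x, (0 <= g x)%R) -> measurable_fun setT g ->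
      \int[Q]_x (g x)%:E = \int[P]_w (G w * g (Y w))%:E).
Proof.
move=> G1; pose weighted_law' : {measure set T -> \bar R} := weighted_law.
(* [mnormalize] supplies the structure of a probability. The mass is one, so no value changes and
   the default [dirac point] is never reached. *)
have QE A : mnormalize weighted_law' (dirac point) A = weighted_law A.
  have w1 : weighted_law setT = 1 by rewrite /weighted_law preimage_setT.
  rewrite /mnormalize /=.
  have -> : weighted_law' setT = 1 by exact: w1.
  by rewrite onee_eq0/= invr1 mule1.
exists (mnormalize weighted_law' (dirac point)).
have H A : measurable A -> mnormalize weighted_law' (dirac point) A = \int[P]_w (G w * \1_A (Y w))%:E.
  by move=> mA; rewrite QE weighted_lawE.
by split => // g g0 mg; exact: integral_of_weighted_law.
Qed.

End weighted_law.

Lemma integral_density {R : realType} {d : measure_display} {T : measurableType d}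
    (nu mu : {measure set T -> \bar R}) (f g : T -> R) :
  density_of nu mu f -> (forall x, 0 <= g x) -> measurable_fun setT g ->
  (\int[nu]_x (g x)%:E = \int[mu]_x (f x * g x)%:E)%E.
Proof.
move=> [mf f0 nuE] g0 mg.
apply: (@integral_of_weighted_law R d d T T mu f id) => // A mA.
rewrite nuE// integral_mkcond; apply: eq_integral => w _.
by rewrite epatch_indic EFinM.
Qed.

(** * Products over independent variables and change of law *)

Section iid.
Context {R : realType} {dO d : measure_display} {Omega : measurableType dO}
  {T : measurableType d} (P : probability Omega R) (X : nat -> Omega -> T)
  (mu : probability T R).
Hypothesis iidX : iid_law P X mu.

Let mX i : measurable_fun setT (X i). Proof. by case: iidX. Qed.

(** Induction on [m], the number of leading factors that may be arbitrary; the later ones, up to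
    [n], are indicators. For [m = 0] this is independence as stated for sets, and each step frees
    one more factor. *)
Lemma iid_integral_prod_ind n m (phi : nat -> T -> R) (c : nat -> R) :
  (forall i x, 0 <= phi i x) -> (forall i, measurable_fun setT (phi i)) ->
  (forall i, \int[mu]_x (phi i x)%:E = (c i)%:E)%E ->
  (forall i, (m <= i < n)%N -> exists2 A, measurable A & phi i = \1_A) ->
  (\int[P]_w (\prod_(i < n) phi i (X i w))%:E = (\prod_(i < n) c i)%:E)%E.
Proof.
elim: m phi c => [|m IH] phi c phi0 mphi phiE ind.
  have /choice[A HA] i : exists A, measurable A /\ ((i < n)%N -> phi i = \1_A).
    have [ni|/= ni] := boolP (i < n)%N; last by exists setT; split.
    by have [A mA ->] := ind i ni; exists A; split.
  have mA i : measurable (A i) by have [] := HA i.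
  have cE i : (i < n)%N -> (c i)%:E = mu (A i).
    by move=> ni; have [_ /(_ ni) pE] := HA i; rewrite -phiE pE integral_indic// setIT.
  case: iidX => _ lawX indep.
  have := indep (iota 0 n) A (iota_uniq _ _) mA.
  rewrite -(@big_mkord _ _ _ n xpredT c) -(subn0 n) -/(index_iota 0 n) => {}indep.
  transitivity (P (\big[setI/setT]_(i <- index_iota 0 n) (X i @^-1` A i))).
    rewrite -[X in P X]setIT -(@integral_indic _ _ _ P setT)//; last first.
      apply: bigsetI_measurable => i _.
      by rewrite -[X in measurable X]setTI; exact: mX.
    apply: eq_integral => w _; congr EFin.
    rewrite subn0 -(@big_mkord _ _ _ n xpredT (fun i => phi i (X i w))).
    rewrite [index_iota _ _]/index_iota subn0.
    have : forall i, i \in iota 0 n -> phi i (X i w) = \1_(A i) (X i w).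
      by move=> i; rewrite mem_iota add0n => /= ni; have [_ ->] := HA i.
    elim: (iota 0 n) => [|i s IHs] His; first by rewrite !big_nil indicT.
    rewrite !big_cons indicI/= IHs; last by move=> j js; apply: His; rewrite inE js orbT.
    by rewrite His ?mem_head.
  rewrite indep -prodEFin subn0 !big_mkord; apply: eq_bigr => i _.
  by rewrite lawX// cE.
have [nm|mn] := leqP n m.
  apply: (IH phi c) => // i /andP[mi ni].
  by have := leq_trans (leq_ltn_trans mi ni) nm; rewrite ltnn.
pose m' := Ordinal mn.
have c0 i : 0 <= c i.
  by rewrite -lee_fin -phiE; apply: integral_ge0 => x _; rewrite lee_fin.
pose C : R := \prod_(i < n | i != m') c i.
have C0 : 0 <= C by apply: prodr_ge0.
pose G w := \prod_(i < n | i != m') phi i (X i w).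
(* With the indicator of [A] as factor [m] the induction hypothesis applies. As [A] varies, it says
   that [C mu] is the image under [X m] of [P] weighted by the other factors, and this passes from
   sets to the function [phi m]. *)
have H A : measurable A -> mscale (NngNum C0) mu A =
    (\int[P]_w (G w * \1_A (X m w))%:E)%E.
  move=> mA.
  pose phi' i := if i == m then \1_A : T -> R else phi i.
  pose c' i := if i == m then fine (mu A) else c i.
  have := IH phi' c'.
  have -> : (\int[P]_w (\prod_(i < n) phi' i (X i w))%:E =
      \int[P]_w (G w * \1_A (X m w))%:E)%E.
    apply: eq_integral => w _; congr EFin.
    rewrite (bigD1 m')//= mulrC {2}/phi' eqxx; congr (_ * _).
    apply: eq_bigr => i im; rewrite /phi' ifN//.
  have -> : \prod_(i < n) c' i = C * fine (mu A).
    rewrite (bigD1 m')//= mulrC {2}/c' eqxx; congr (_ * _).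
    apply: eq_bigr => i im; rewrite /c' ifN//.
  rewrite EFinM fineK ?fin_num_measure// => -> //.
  - by move=> i x; rewrite /phi'; case: ifP.
  - by move=> i; rewrite /phi'; case: ifP.
  - move=> i; rewrite /phi' /c'; case: ifP => // _.
    by rewrite integral_indic// setIT fineK ?fin_num_measure.
  - move=> i /andP[mi ni]; rewrite /phi'; case: eqP => [_|/eqP im]; first by exists A.
    by apply: ind; rewrite ni andbT ltn_neqAle eq_sym im.
have := @integral_of_weighted_law R dO d Omega T P G (X m) _ _ _ (mscale (NngNum C0) mu) (phi m) H.
rewrite ge0_integral_mscale//; last 2 first.
- exact/measurable_EFinP.
- by move=> x _; rewrite lee_fin.
rewrite phiE -EFinM/= => HH.
rewrite [RHS](_ : _ = (C * c m)%:E); last by rewrite (bigD1 m')//= mulrC.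
rewrite HH//; last first.
- rewrite (_ : G = fun w => \prod_(i < n) if i != m' then phi i (X i w) else 1)%R; last first.
    by apply/funext => w; exact: big_mkcond.
  apply: measurable_prod => i _; case: (i != m') => //.
  by apply: measurableT_comp.
- by move=> w; apply: prodr_ge0 => i _.
apply: eq_integral => w _. by rewrite (bigD1 m')//= mulrC.
Qed.

Lemma iid_integral_prod n (phi : nat -> T -> R) (c : nat -> R) :
  (forall i x, 0 <= phi i x) -> (forall i, measurable_fun setT (phi i)) ->
  (forall i, \int[mu]_x (phi i x)%:E = (c i)%:E)%E ->
  (\int[P]_w (\prod_(i < n) phi i (X i w))%:E = (\prod_(i < n) c i)%:E)%E.
Proof.
(* For [m = n] the condition on indicators is vacuous. *)
move=> ? ? ?; apply: (@iid_integral_prod_ind n n) => // i /andP[ni /(leq_ltn_trans ni)].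
by rewrite ltnn.
Qed.

(* The last clause says that under [Q] the first [n] variables are i.i.d. with law [nu] *)
Lemma change_of_law (nu : probability T R) (f : T -> R) n : density_of nu mu f ->
  exists Q : probability Omega R,
    [/\ forall A, measurable A ->
          (Q A = \int[P]_w ((\prod_(i < n) f (X i w)) * \1_A w)%:E)%E,
        forall g : Omega -> R, (forall w, 0 <= g w) -> measurable_fun setT g ->
          (\int[Q]_w (g w)%:E = \int[P]_w ((\prod_(i < n) f (X i w)) * g w)%:E)%E &
        forall (psi : nat -> T -> R) (c : nat -> R),
          (forall i x, 0 <= psi i x) -> (forall i, measurable_fun setT (psi i)) ->
          (forall i, \int[nu]_x (psi i x)%:E = (c i)%:E)%E ->
          (\int[Q]_w (\prod_(i < n) psi i (X i w))%:E = (\prod_(i < n) c i)%:E)%E].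
Proof.
move=> fdens; have [mf f0 nuE] := fdens.
have f1 : (\int[mu]_x (f x)%:E = 1)%E by rewrite -nuE// probability_setT.
pose F w := \prod_(i < n) f (X i w).
have F0 w : 0 <= F w by apply: prodr_ge0.
have mF : measurable_fun setT F.
  by apply: measurable_prod => i _; apply: measurableT_comp.
have F1 : (\int[P]_w (F w)%:E = 1)%E.
  by rewrite (@iid_integral_prod n (fun=> f) (fun=> 1))// big1.
have [Q [QE QI]] := @weighted_law_probability R dO dO Omega Omega P F id F0 mF (@measurable_id _ _ _) F1.
exists Q; split => // psi c psi0 mpsi psiE.
rewrite QI//; last 2 first.
- by move=> w; apply: prodr_ge0.
- by apply: measurable_prod => i _; apply: measurableT_comp.
(* Under [P] the factors are [f * psi i], whose [mu]-integrals are the [nu]-integrals of [psi i]. *)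
rewrite -(@iid_integral_prod n (fun i x => f x * psi i x) c).
- by apply: eq_integral => w _; rewrite -big_split.
- by move=> i x; rewrite mulr_ge0.
- by move=> i; apply: measurable_funM.
- by move=> i; rewrite -(integral_density fdens).
Qed.

End iid.

(** * A power inequality and averages of measures *)

Lemma powR_quasi_triangle {R : realType} (p s a b : R) : 0 <= p -> 0 < s -> 0 <= a -> 0 <= b ->
  (a + b) `^ p <= (1 + s) `^ p * a `^ p + (1 + s^-1) `^ p * b `^ p.
Proof.
move=> p0 s0 a0 b0.
have s1 : 0 <= 1 + s by rewrite addr_ge0// ltW.
(* Either [b <= s a], and then [a + b <= (1 + s) a], or [a < b / s], and then
   [a + b <= (1 + 1/s) b]. *)
have [bsa|sab] := leP b (s * a).
  apply: (@le_trans _ _ ((1 + s) `^ p * a `^ p)); last by rewrite lerDl mulr_ge0 ?powR_ge0.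
  rewrite -powRM//; apply: (ge0_ler_powR p0); rewrite ?nnegrE.
  - by rewrite addr_ge0.
  - by rewrite mulr_ge0.
  - by rewrite mulrDl mul1r lerD2l.
apply: (@le_trans _ _ ((1 + s^-1) `^ p * b `^ p)); last by rewrite lerDr mulr_ge0 ?powR_ge0.
have s0' : 0 <= s^-1 by rewrite invr_ge0 ltW.
rewrite -powRM ?addr_ge0//; apply: (ge0_ler_powR p0); rewrite ?nnegrE.
- by rewrite addr_ge0.
- by rewrite mulr_ge0 ?addr_ge0.
- by rewrite mulrDl mul1r addrC lerD2l mulrC ler_pdivlMr// mulrC ltW.
Qed.

Lemma average_probability {R : realType} {d : measure_display} {S : measurableType d}
    n (m : nat -> probability S R) : (0 < n)%N ->
  exists gam : probability S R,
    (forall A, gam A = (n%:R^-1)%:E * \sum_(i < n) m i A)%E /\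
    (forall g : S -> R, (forall x, 0 <= g x) -> measurable_fun setT g ->
      (\int[gam]_x (g x)%:E = (n%:R^-1)%:E * \sum_(i < n) \int[m i]_x (g x)%:E)%E).
Proof.
move=> n0.
have n0' : 0 <= (n%:R : R)^-1 by rewrite invr_ge0.
pose k := NngNum n0'.
pose av : {measure set S -> \bar R} := mscale k (msum m n).
have avE A : (av A = (n%:R^-1)%:E * \sum_(i < n) m i A)%E by [].
have av1 : av setT = 1%E.
  rewrite avE; under eq_bigr do rewrite probability_setT.
  rewrite sumEFin sumr_const card_ord -EFinM mulVf// pnatr_eq0 -lt0n//.
pose gam := mnormalize av (m 0%N).
have gamE A : gam A = av A.
  by rewrite /gam /mnormalize /= av1 onee_eq0/= invr1 mule1.
exists gam; split; first by move=> A; rewrite -avE; exact: gamE.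
move=> g g0 mg.
have mg' : measurable_fun setT (EFin \o g) by exact/measurable_EFinP.
rewrite (@eq_measure_integral _ _ _ setT av); last by move=> A _ _; exact: gamE.
rewrite ge0_integral_mscale//; last by move=> x _; rewrite lee_fin.
by rewrite ge0_integral_measure_sum// => x _; rewrite lee_fin.
Qed.

(** * Measurability of the metric *)

Section polish.
Context {R : realType} {d : measure_display} {T : measurableType d} (rho : T -> T -> R).
Hypothesis Hpol : polish_borel rho.

Lemma rho_ge0 x y : 0 <= rho x y. Proof. by case: Hpol => [[+ _] _ _ _]; exact. Qed.

Lemma rho_refl x : rho x x = 0.
Proof. by case: Hpol => [[_ [+ _]] _ _ _] => /(_ x x) [_]; apply. Qed.

Lemma rho_eq0 x y : rho x y = 0 -> x = y.
Proof. by case: Hpol => [[_ [+ _]] _ _ _] => /(_ x y) []. Qed.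

Lemma rhoC x y : rho x y = rho y x.
Proof. by case: Hpol => [[_ [_ [+ _]]] _ _ _]; exact. Qed.

Lemma rho_triangle x y z : rho x z <= rho x y + rho y z.
Proof. by case: Hpol => [[_ [_ [_ +]]] _ _ _]; exact. Qed.

Lemma measurable_rho_open U : rho_open rho U -> measurable U.
Proof. by case: Hpol => _ _ _ -> oU; exact: sub_sigma_algebra. Qed.

Lemma measurable_fun_rho x : measurable_fun setT (rho x).
Proof.
move=> mD; apply: (measurability _ (RGenInftyO.measurableE R)) => //.
move=> _ [_ [r ->] <-]; rewrite setTI; apply: measurable_rho_open => y /=.
rewrite in_itv/= => yr; exists (r - rho x y); first by rewrite subr_gt0.
move=> z /= yz; rewrite in_itv/=; have := rho_triangle x y z; lra.
Qed.

Lemma measurable_singleton (x : T) : d.-measurable [set x].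
Proof.
rewrite (_ : [set x] = rho x @^-1` [set 0]).
  by rewrite -[X in measurable X]setTI; apply: measurable_fun_rho => //.
by apply/seteqP; split => y /=; [move=> ->; exact: rho_refl|move/rho_eq0].
Qed.

Lemma dense_sequence : exists a : nat -> T, forall x (e : R), 0 < e -> exists k, rho (a k) x < e.
Proof.
case: Hpol => _ _ [D [cD dD]] _.
(* Enumerating [D] requires that it be non-empty, and it is: it comes within distance one of
   [point]. *)
move: cD => /pfcard_geP[D0|[f]].
  by have [y] := dD point 1 ltr01; rewrite D0.
exists f => x e e0; have [y Dy yx] := dD x e e0.
by have [k _ fk] := @surj _ _ _ _ f y Dy; exists k; rewrite fk rhoC.
Qed.

(** Separability makes the metric measurable for the product sigma-algebra: [rho < r] is a countable
    union of products of two balls with a common centre in the dense sequence. *)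
Lemma measurable_fun_rho2 : measurable_fun setT (fun z : T * T => rho z.1 z.2).
Proof.
move=> mD; apply: (measurability _ (RGenInftyO.measurableE R)) => //.
move=> _ [_ [r ->] <-]; rewrite setTI.
have [a Ha] := dense_sequence.
rewrite (_ : _ @^-1` _ = \bigcup_k \bigcup_j
   ((rho (a k) @^-1` `]-oo, j.+1%:R^-1[) `*` (rho (a k) @^-1` `]-oo, r - j.+1%:R^-1[))).
  apply: bigcup_measurable => k _; apply: bigcup_measurable => j _.
  by apply: measurableX; rewrite -[X in measurable X]setTI; exact: measurable_fun_rho.
apply/seteqP; split => -[x y] /=; rewrite in_itv/=.
  move=> xyr.
  (* The small radius [1/(j+1)] is spent twice: once to reach [x], once as the margin left in the
     ball around [y]. *)
  have e0 : 0 < (r - rho x y) / 2 by rewrite divr_gt0// subr_gt0.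
  have [j _ jP] := near_infty_natSinv_lt (PosNum e0).
  have je : j.+1%:R^-1 < (r - rho x y) / 2 := jP j (leqnn j).
  have j0 : 0 < j.+1%:R^-1 :> R by rewrite invr_gt0.
  have [k ak] := Ha x _ j0.
  exists k => //; exists j => //; split => /=; rewrite in_itv/=//.
  move: (rho_triangle (a k) x y) je ak; move: (j.+1%:R^-1) => q; lra.
move=> [k _ [j _ [/=]]]; rewrite !in_itv/= => ax ay.
move: (rho_triangle x (a k) y) ax ay; rewrite (rhoC x (a k)).
by move: (j.+1%:R^-1) => q; lra.
Qed.

End polish.

(** * Gluing transport plans through an atomic measure *)

Definition atomic_mean {R : realType} {d} {T : measurableType d} n (y : nat -> T) :
    set T -> \bar R :=
  fun A => ((n%:R^-1)%:E * \sum_(i < n) \d_(y i) A)%E.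

Lemma integral_weighted_sum {R : realType} {d : measure_display} {T : measurableType d}
    (m : {measure set T -> \bar R}) n (c : R) (h : nat -> T -> R) :
  0 <= c -> (forall i x, 0 <= h i x) -> (forall i, measurable_fun setT (h i)) ->
  (c%:E * \sum_(i < n) \int[m]_x (h i x)%:E =
   \int[m]_x (c * \sum_(i < n) h i x)%:E)%E.
Proof.
move=> c0 h0 mh.
rewrite -(@ge0_integral_sum _ _ _ m _ measurableT _ (fun (i : 'I_n) x => (h i x)%:E)); last 2 first.
- by move=> i; exact/measurable_EFinP.
- by move=> i x _; rewrite lee_fin.
rewrite -ge0_integralZl//.
- by apply: eq_integral => x _; rewrite sumEFin EFinM.
- by apply: emeasurable_sum => i; exact/measurable_EFinP.
- by move=> x _; rewrite sume_ge0// => i _; rewrite lee_fin.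
Qed.

Section glue.
Context {R : realType} {d : measure_display} {T : measurableType d} (rho : T -> T -> R).
Hypothesis Hpol : polish_borel rho.
Variables (p : R) (mu : probability T R).
Hypothesis p0 : 0 <= p.

Let mcost : measurable_fun setT (fun z : T * T => rho z.1 z.2 `^ p).
Proof.
by apply: (measurableT_comp (measurable_powR _)) => //; exact: measurable_fun_rho2.
Qed.

Let mcost1 x : measurable_fun setT (fun y : T => rho x y `^ p).
Proof.
by apply: (measurableT_comp (measurable_powR _)) => //; exact: measurable_fun_rho.
Qed.

(* [pi] is disintegrated over its finitely many atoms [y i] and composed, atom by atom,
   with the measures [sig i], which transport [nu] to [atomic_mean n y] *)
Lemma Tcost_glue n (y : nat -> T) (sig : nat -> probability T R) (nu : set T -> \bar R)
    (pi : probability (T * T)%type R) (s : R) : (0 < n)%N -> 0 < s ->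
  (forall A, measurable A -> nu A = (n%:R^-1)%:E * \sum_(i < n) sig i A)%E ->
  couplings (atomic_mean n y) mu pi ->
  (Tcost rho p nu mu <= ((1 + s) `^ p)%:E * \int[pi]_z (rho z.1 z.2 `^ p)%:E
    + ((1 + s^-1) `^ p)%:E *
      ((n%:R^-1)%:E * \sum_(i < n) \int[sig i]_u (rho (y i) u `^ p)%:E))%E.
Proof.
move=> n0 s0 nuE piC.
have nR0 : (n%:R : R) != 0 by rewrite pnatr_eq0 -lt0n.
have ni0 : 0 <= (n%:R : R)^-1 by rewrite invr_ge0.
have my i : d.-measurable [set y i] by exact: (measurable_singleton Hpol).
(* The points may repeat: [m i] is the multiplicity of [y i], and [pi] gives mass [m i / n] to the
   slice over [y i]. Hence [G i] is the density of [pi] conditioned on that slice. *)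
pose m i : R := \sum_(k < n) \1_[set y i] (y k).
have m0 i : (i < n)%N -> 0 < m i.
  move=> ni; apply: (@lt_le_trans _ _ (\1_[set y i] (y i) : R)).
    by rewrite indicE mem_set.
  by rewrite /m (bigD1 (Ordinal ni))//= lerDl sumr_ge0.
have m0' i : 0 <= m i by rewrite /m sumr_ge0.
pose G i (z : T * T) : R := n%:R / m i * \1_[set y i] z.1.
have G0 i z : 0 <= G i z by rewrite mulr_ge0// divr_ge0.
have mG i : measurable_fun setT (G i).
  apply: measurable_funM => //; apply: measurableT_comp; last exact: measurable_fst.
  by [].
have mG' i : measurable_fun setT (fun z : T * T => (\1_[set y i] z.1 : R)).
  apply: measurableT_comp; last exact: measurable_fst.
  by [].
have G1 i : (i < n)%N -> (\int[pi]_z (G i z)%:E = 1)%E.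
  move=> ni; under eq_integral do rewrite EFinM.
  rewrite ge0_integralZl//; last 2 first.
  - exact/measurable_EFinP.
  - by rewrite lee_fin divr_ge0.
  have -> : (\int[pi]_z (\1_[set y i] z.1)%:E = pi ([set y i] `*` setT))%E.
    rewrite -[in RHS](setIT (_ `*` _)) -integral_indic//; last exact: measurableX.
    apply: eq_integral => -[u v] _; congr EFin; rewrite !indicE; congr (_%:R).
    by congr nat_of_bool; apply/idP/idP; rewrite !inE/=; [|case].
  have [-> _] := piC _ (my i).
  rewrite /atomic_mean; under eq_bigr do rewrite diracE -indicE.
  rewrite sumEFin -!EFinM -/(m i); congr EFin.
  by rewrite mulrACA divff// mul1r mulVf// gt_eqF// m0.
(* [Q i] is the conditional law under [pi] of the second coordinate given that the first is [y i];
   [mu] is a default for [i >= n]. *)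
have /choice[Q HQ] i : exists Q : probability T R, (i < n)%N ->
    (forall A, measurable A -> (Q A = \int[pi]_w (G i w * \1_A w.2)%:E)%E) /\
    (forall g : T -> R, (forall x, 0 <= g x) -> measurable_fun setT g ->
      (\int[Q]_x (g x)%:E = \int[pi]_w (G i w * g w.2)%:E)%E).
  have [ni|ni] := boolP (i < n)%N; last by exists mu.
  have [Q HQ] := @weighted_law_probability R _ _ (T * T)%type T pi (G i) snd (G0 i) (mG i) measurable_snd (G1 i ni).
  by exists Q.
pose S : set T := \big[setU/set0]_(k < n) [set y k].
have mS : measurable S by apply: bigsetU_measurable => k _; exact: my.
have Sy i : (i < n)%N -> S (y i).
  by move=> ni; rewrite /S -(bigcup_mkord n (fun k => [set y k])); exists i.
(* An atom of multiplicity [m] occurs for [m] indices, each with weight [1/n * n/m], so the weights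
   add up to one on [S]. *)
have SG (z : T * T) : n%:R^-1 * \sum_(i < n) G i z = \1_S z.1.
  rewrite mulr_sumr.
  have -> : \sum_(i < n) n%:R^-1 * G i z = \sum_(i < n) \1_[set z.1] (y i) / \sum_(k < n) \1_[set z.1] (y k).
    apply: eq_bigr => i _; rewrite /G !mulrA mulVf// mul1r mulrC !indicE /=.
    have [yz|yz] := pselect (y i = z.1).
      by rewrite !mem_set//= -yz.
    by rewrite !memNset//= ?mul0r// => /esym.
  rewrite -mulr_suml indicE.
  have [Sz|Sz] := pselect (S z.1).
    rewrite mem_set//= divff//.
    move: Sz; rewrite /S -(bigcup_mkord n (fun k => [set y k])) => -[i /= ni zy].
    by have := m0 _ ni; rewrite /m -zy => /gt_eqF ->.
  rewrite memNset// big1 ?mul0r// => i _; rewrite indicE memNset//= => yz.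
  by apply: Sz; rewrite -yz; exact: Sy.
(* The glued plan: given the index [i], its two coordinates are drawn independently from [sig i] and
   [Q i]. *)
have [gam [gamE gamI]] := @average_probability R _ (T * T)%type n
  (fun i => (sig i \x Q i)%E : probability (T * T)%type R) n0.
have gamC : couplings nu mu gam.
  move=> A mA; split.
    rewrite gamE nuE//; congr *%E; apply: eq_bigr => i _.
    by rewrite [LHS]product_measure1E// -[RHS]mule1; congr *%E; exact: probability_setT.
  rewrite gamE.
  have -> : (\sum_(i < n) (sig i \x Q i : probability (T * T)%type R) (setT `*` A) =
      \sum_(i < n) \int[pi]_w (G i w * \1_A w.2)%:E)%E.
    apply: eq_bigr => i _; rewrite [LHS]product_measure1E//.
    have [QE _] := HQ i (ltn_ord i).
    by rewrite -QE// -[RHS]mul1e; congr *%E; exact: probability_setT.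
  have mA2 : measurable_fun setT (fun w : T * T => \1_A w.2 : R).
    by apply: measurableT_comp; last exact: measurable_snd.
  rewrite (@integral_weighted_sum _ _ _ pi n _ (fun i w => G i w * \1_A w.2))//; last 2 first.
  - by move=> i w; rewrite mulr_ge0.
  - by move=> i; apply: measurable_funM.
  under eq_integral => w _ do rewrite -mulr_suml mulrA SG.
  (* The second marginal of [gam] at [A] is [pi (S x A)]; this is [mu A] because the first marginal
     of [pi] does not charge the complement of [S]. *)
  have -> : (\int[pi]_w (\1_S w.1 * \1_A w.2)%:E = pi (S `*` A))%E.
    rewrite -[in RHS](setIT (_ `*` _)) -integral_indic//; last exact: measurableX.
    apply: eq_integral => -[u v] _; congr EFin; rewrite !indicE -natrM mulnb.
    by congr (nat_of_bool _)%:R; apply/andP/idP; rewrite !inE/=.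
  have [_ <-] := piC A mA.
  have mSC : measurable (~` S) by exact: measurableC.
  have piS : (pi (~` S `*` setT) = 0)%E.
    have [-> _] := piC _ mSC; rewrite /atomic_mean big1 ?mule0// => i _.
    by rewrite diracE memNset//= => /(_ (Sy _ (ltn_ord i))).
  apply/eqP; rewrite eq_le; apply/andP; split.
    apply: le_measure; rewrite ?inE; [exact: measurableX|exact: measurableX|].
    by move=> [u v] [].
  apply: (@le_trans _ _ (pi ((S `*` A) `|` (~` S `*` setT)))).
    apply: le_measure; rewrite ?inE; [exact: measurableX| |].
      by apply: measurableU; exact: measurableX.
    by move=> [u v] [_ /= Av]; have [Su|Su] := pselect (S u); [left|right].
  apply: (@le_trans _ _ (pi (S `*` A) + pi (~` S `*` setT))%E).
    by apply: measureU2; exact: measurableX.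
  by rewrite piS adde0.
apply: (@le_trans _ _ (\int[gam]_z (rho z.1 z.2 `^ p)%:E)%E).
  by apply: ereal_inf_lbound; exists gam.
rewrite gamI//; last by move=> z; exact: powR_ge0.
set a := (1 + s) `^ p; set b := (1 + s^-1) `^ p.
have a0 : 0 <= a by exact: powR_ge0.
have b0 : 0 <= b by exact: powR_ge0.
(* The triangle inequality through [y i] separates the two independent coordinates. *)
have step i : (i < n)%N -> (\int[sig i \x Q i]_z (rho z.1 z.2 `^ p)%:E <=
    a%:E * \int[pi]_w (G i w * rho (y i) w.2 `^ p)%:E
    + b%:E * \int[sig i]_u (rho (y i) u `^ p)%:E)%E.
  move=> ni.
  have [_ QI] := HQ i ni.
  rewrite -(QI (fun v => rho (y i) v `^ p))//; last by move=> x; exact: powR_ge0.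
  rewrite fubini_tonelli1//; last 2 first.
  - exact/measurable_EFinP.
  - by move=> z; rewrite lee_fin powR_ge0.
  rewrite /fubini_F /=.
  have mI : measurable_fun setT (fun v => (rho (y i) v `^ p)%:E) by exact/measurable_EFinP.
  apply: (@le_trans _ _ (\int[sig i]_u (a%:E * \int[Q i]_v (rho (y i) v `^ p)%:E + b%:E * (rho (y i) u `^ p)%:E))%E).
    apply: ge0_le_integral => //.
    - by move=> u _; apply: integral_ge0 => v _; rewrite lee_fin powR_ge0.
    - apply: (@measurable_fun_fubini_tonelli_F _ _ _ _ _ (Q i) (fun z => (rho z.1 z.2 `^ p)%:E)).
      + exact/measurable_EFinP.
      + by move=> z; rewrite lee_fin powR_ge0.
    - apply: emeasurable_funD => //; apply: measurable_funeM => //.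
    - move=> u _.
      apply: (@le_trans _ _ (\int[Q i]_v (a%:E * (rho (y i) v `^ p)%:E + b%:E * (rho (y i) u `^ p)%:E))%E).
        apply: ge0_le_integral => //.
        + by move=> v _; rewrite lee_fin powR_ge0.
        + exact/measurable_EFinP.
        + by apply: emeasurable_funD => //; apply: measurable_funeM => //.
        + move=> v _; rewrite -!EFinM -EFinD lee_fin.
          apply: (le_trans _ (@powR_quasi_triangle _ p s (rho (y i) v) (rho (y i) u) p0 s0 _ _)).
          * apply: (ge0_ler_powR p0); rewrite ?nnegrE ?addr_ge0 ?(rho_ge0 Hpol)//.
            by rewrite addrC (rhoC Hpol (y i) u); exact: (rho_triangle Hpol).
          * exact: (rho_ge0 Hpol).
          * exact: (rho_ge0 Hpol).
      rewrite ge0_integralD//; last 3 first.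
      + by move=> v _; rewrite -EFinM lee_fin mulr_ge0// powR_ge0.
      + by apply: measurable_funeM.
      + by move=> v _; rewrite -EFinM lee_fin mulr_ge0// powR_ge0.
      rewrite ge0_integralZl//; last by move=> v _; rewrite lee_fin powR_ge0.
      rewrite integral_cst//; apply: leeD2l; rewrite -[leRHS]mule1.
      apply: lee_wpmul2l; last exact: probability_le1.
      by rewrite lee_fin mulr_ge0// powR_ge0.
  rewrite ge0_integralD//; last 3 first.
  - by move=> v _; rewrite mule_ge0 ?lee_fin//; apply: integral_ge0 => u _; rewrite lee_fin powR_ge0.
  - by move=> v _; rewrite -EFinM lee_fin mulr_ge0// powR_ge0.
  - by apply: measurable_funeM.
  rewrite [X in (X + _)%E]integral_cst// [X in (_ + X)%E]ge0_integralZl//; last first.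
    by move=> v _; rewrite lee_fin powR_ge0.
  apply: leeD2r; rewrite -[leRHS]mule1.
  apply: lee_wpmul2l; last exact: probability_le1.
  rewrite mule_ge0 ?lee_fin//.
  by apply: integral_ge0 => v _; rewrite lee_fin powR_ge0.
apply: (@le_trans _ _ ((n%:R^-1)%:E * \sum_(i < n) (a%:E * \int[pi]_w (G i w * rho (y i) w.2 `^ p)%:E
    + b%:E * \int[sig i]_u (rho (y i) u `^ p)%:E))%E).
  apply: lee_wpmul2l; first by rewrite lee_fin.
  by apply: lee_sum => i _; exact: step.
have mGr i : measurable_fun setT (fun w : T * T => G i w * rho (y i) w.2 `^ p).
  apply: measurable_funM => //.
  by apply: (measurableT_comp (mcost1 (y i))); exact: measurable_snd.
have I0 i : (0 <= \int[pi]_w (G i w * rho (y i) w.2 `^ p)%:E)%E.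
  by apply: integral_ge0 => w _; rewrite lee_fin mulr_ge0// powR_ge0.
have J0 i : (0 <= \int[sig i]_w (rho (y i) w `^ p)%:E)%E.
  by apply: integral_ge0 => w _; rewrite lee_fin powR_ge0.
rewrite big_split/= -ge0_sume_distrr// -ge0_sume_distrr//.
rewrite ge0_muleDr; last 2 first.
- by rewrite mule_ge0 ?lee_fin// sume_ge0.
- by rewrite mule_ge0 ?lee_fin// sume_ge0.
rewrite muleCA [X in (_ + X)%E]muleCA; apply: leeD2r.
apply: lee_wpmul2l; first by rewrite lee_fin.
rewrite (@integral_weighted_sum _ _ _ pi n _ (fun i w => G i w * rho (y i) w.2 `^ p))//; last first.
  by move=> i w; rewrite mulr_ge0// powR_ge0.
apply: ge0_le_integral => //.
- by move=> w _; rewrite lee_fin mulr_ge0// sumr_ge0// => i _; rewrite mulr_ge0// powR_ge0.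
- apply/measurable_EFinP/measurable_funM => //.
  by apply: measurable_sum => i.
- exact/measurable_EFinP.
move=> w _; rewrite lee_fin.
(* [G i] vanishes off the slice over [y i], so [y i] may be replaced by the first coordinate; the
   weights then average to [\1_S <= 1]. *)
have -> : \sum_(i < n) G i w * rho (y i) w.2 `^ p = \sum_(i < n) G i w * rho w.1 w.2 `^ p.
  apply: eq_bigr => i _; rewrite /G indicE.
  have [yz|yz] := pselect ([set y i] w.1); first by rewrite yz.
  by rewrite memNset// mulr0 !mul0r.
rewrite -mulr_suml mulrA SG -[leRHS]mul1r ler_wpM2r ?powR_ge0//.
Qed.

End glue.

(** * Stability of the transport cost and measurability of the event *)

Section lower_semicontinuity.
Context {R : realType} {d : measure_display} {T : measurableType d} (rho : T -> T -> R).
Hypothesis Hpol : polish_borel rho.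
Variables (p : R) (mu : probability T R).
Hypothesis p0 : 0 < p.

Lemma Tcost_ge0 (nu1 nu2 : set T -> \bar R) : (0 <= Tcost rho p nu1 nu2)%E.
Proof.
apply: le_ereal_inf_tmp => _ [pi _ <-].
by apply: integral_ge0 => z _; rewrite lee_fin powR_ge0.
Qed.

Lemma lt_Wdist (nu1 nu2 : set T -> \bar R) (t : R) : 0 <= t ->
  (t%:E < Wdist rho p nu1 nu2)%E = ((t `^ p)%:E < Tcost rho p nu1 nu2)%E.
Proof.
move=> t0; rewrite /Wdist; have := Tcost_ge0 nu1 nu2.
have p0' : p != 0 by rewrite gt_eqF.
have pi0 : 0 < p^-1 by rewrite invr_gt0.
case: (Tcost rho p nu1 nu2) => [r| |]//.
  rewrite lee_fin poweR_EFin !lte_fin => r0.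
  apply/idP/idP => H.
    have := @gt0_ltr_powR _ p p0 t (r `^ p^-1) _ _ H.
    by rewrite !nnegrE -powRrM mulVf// powRr1//; apply => //; exact: powR_ge0.
  have := @gt0_ltr_powR _ p^-1 pi0 (t `^ p) r _ _ H.
  by rewrite !nnegrE -powRrM divff// powRr1//; apply => //; exact: powR_ge0.
by move=> _; rewrite poweRyr ?invr_eq0// !ltry.
Qed.

(** A cheap coupling of [atomic_mean n y] with [mu], glued to the plan given by [sig], would make
    [T_p(nu, mu)] too small. The threshold [c0] depends neither on [n] nor on [y] or [sig], so it
    can be fixed before the sample is drawn. *)
Lemma Tcost_lsc (nu : set T -> \bar R) (tau : R) : 0 <= tau ->
  (tau%:E < Tcost rho p nu mu)%E ->
  exists2 c0 : R, 0 < c0 & forall n (y : nat -> T) (sig : nat -> probability T R),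
    (0 < n)%N ->
    (forall A, measurable A -> nu A = (n%:R^-1)%:E * \sum_(i < n) sig i A)%E ->
    ((n%:R^-1)%:E * \sum_(i < n) \int[sig i]_u (rho (y i) u `^ p)%:E <= c0%:E)%E ->
    (tau%:E < Tcost rho p (atomic_mean n y) mu)%E.
Proof.
move=> tau0 tauT.
have [tau2 tt2 t2T] : exists2 tau2 : R, tau < tau2 & (tau2%:E < Tcost rho p nu mu)%E.
  move: tauT; case: (Tcost rho p nu mu) => [r| |]//.
    rewrite lte_fin => tr; exists ((tau + r) / 2); last rewrite lte_fin; lra.
  by move=> _; exists (tau + 1); rewrite ?ltry// ltrDl.
(* In the chain [tau < tau1 < mid < tau2], [s] solves [(1 + s)^p tau1 = mid] and the threshold [c0]
   below solves [mid + C c0 = tau2]. Here [tau1] is positive even if [tau = 0]. *)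
pose tau1 := (tau + tau2) / 2; pose mid := (tau1 + tau2) / 2.
have tau10 : 0 < tau1 by rewrite /tau1; lra.
have r1 : 1 < mid / tau1 by rewrite ltr_pdivlMr// mul1r /mid /tau1; lra.
pose s := (mid / tau1) `^ p^-1 - 1.
have s0 : 0 < s.
  rewrite subr_gt0; have {1}-> : 1 = 1 `^ p^-1 :> R by rewrite powR1.
  apply: gt0_ltr_powR => //.
  - by rewrite invr_gt0.
  - by rewrite nnegrE.
  - by rewrite nnegrE ltW// (lt_trans _ r1).
have sE : (1 + s) `^ p * tau1 = mid.
  rewrite /s addrC subrK -powRrM mulVf ?gt_eqF// powRr1; last by rewrite ltW// (lt_trans _ r1).
  by rewrite divfK// gt_eqF.
pose C := (1 + s^-1) `^ p.
have C0 : 0 < C by apply: powR_gt0; rewrite addr_gt0// invr_gt0.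
exists ((tau2 - mid) / C); first by rewrite divr_gt0// /mid /tau1; lra.
move=> n y sig n0 nuE cost.
(* An infimum of numbers above [tau] could equal [tau], so every coupling is bounded below by [tau1]
   instead. *)
apply: (@lt_le_trans _ _ tau1%:E); first by rewrite lte_fin /tau1; lra.
apply: le_ereal_inf_tmp => _ [pi piC <-].
rewrite leNgt; apply/negP => small.
have := Tcost_glue Hpol (ltW p0) n0 s0 nuE piC.
apply/negP; rewrite -ltNge; apply: le_lt_trans t2T.
have -> : tau2%:E = (((1 + s) `^ p)%:E * tau1%:E + C%:E * ((tau2 - mid) / C)%:E)%E.
  by rewrite -!EFinM -EFinD sE mulrCA divff ?gt_eqF// mulr1 addrC subrK.
apply: leeD.
  by apply: lee_wpmul2l; [rewrite lee_fin powR_ge0|exact: ltW].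
by apply: lee_wpmul2l => //; rewrite lee_fin ltW.
Qed.

(** [U] is open for the largest of the first [n] coordinate distances, hence a union of boxes
    centred at points of the dense sequence with radius [1/(j+1)]. A box is coded by a list of
    indices and [j], so there are countably many. *)
Lemma measurable_preimage_open n (U : set (nat -> T)) {dO} (Omega : measurableType dO)
    (X : nat -> Omega -> T) : (forall i, measurable_fun setT (X i)) ->
  (forall x, U x -> exists2 q : R, 0 < q & forall y,
    (forall i, (i < n)%N -> rho (x i) (y i) < q) -> U y) ->
  measurable [set w | U (fun i => X i w)].
Proof.
move=> mX oU.
have [a Ha] := dense_sequence Hpol.
pose ball (sj : seq nat * nat) : set (nat -> T) :=
  [set y | forall i, (i < n)%N -> rho (a (nth 0%N sj.1 i)) (y i) < sj.2.+1%:R^-1].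
rewrite (_ : mkset _ = \bigcup_(sj in [set sj | ball sj `<=` U])
    \bigcap_(i in `I_n) (X i @^-1` (rho (a (nth 0%N sj.1 i)) @^-1` `]-oo, sj.2.+1%:R^-1[))).
  rewrite bigcup_mkcond; apply: countable_bigcupT_measurable => [|sj]; first exact: countableP.
  case: ifP => // _; apply: bigcap_measurableType => i _.
  rewrite -[X in measurable X]setTI; apply: mX => //.
  by rewrite -[X in measurable X]setTI; apply: measurable_fun_rho.
apply/seteqP; split => w /=.
  move=> Uw; have [q q0 Hq] := oU _ Uw.
  have e0 : 0 < q / 2 by rewrite divr_gt0.
  have [j _ jP] := near_infty_natSinv_lt (PosNum e0).
  have je : j.+1%:R^-1 < q / 2 := jP j (leqnn j).
  have j0 : 0 < j.+1%:R^-1 :> R by rewrite invr_gt0.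
  have /choice[k Hk] i := Ha (X i w) _ j0.
  exists (mkseq k n, j) => /=; last first.
    by move=> i /= ni; rewrite in_itv/= nth_mkseq.
  move=> y yb; apply: Hq => i ni.
  have := yb i ni; rewrite /= nth_mkseq//; move: (Hk i) je.
  have := rho_triangle Hpol (X i w) (a (k i)) (y i).
  rewrite (rhoC Hpol (X i w) (a (k i))).
  by move: (j.+1%:R^-1) => e; lra.
move=> [[s j] /= bU H]; apply: bU => i ni /=.
by have := H i ni; rewrite /= in_itv.
Qed.

(** The set of sample points that satisfy the inequality is open: [Tcost_lsc] applies to the atomic
    measure itself, moving each [x i] to [y i], so that [sig i] is the Dirac mass at [x i]. *)
Lemma measurable_Wdist_gt n (t : R) {dO} (Omega : measurableType dO)
    (X : nat -> Omega -> T) : (0 < n)%N -> 0 <= t ->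
  (forall i, measurable_fun setT (X i)) ->
  measurable [set w | (t%:E < Wdist rho p (empirical X n w) mu)%E].
Proof.
move=> n0 t0 mX.
apply: (@measurable_preimage_open n
  [set x | (t%:E < Wdist rho p (atomic_mean n x) mu)%E] _ _ _ mX) => x /=.
rewrite lt_Wdist// => /(Tcost_lsc (powR_ge0 _ _))[c0 c00 H].
exists (c0 `^ p^-1); first exact: powR_gt0.
move=> y xy; rewrite lt_Wdist//.
apply: (H n y (fun i => \d_(x i) : probability T R)) => //.
rewrite lee_pdivrMl ?ltr0n//.
apply: (@le_trans _ _ (\sum_(i < n) c0%:E)%E); last first.
  by rewrite sumEFin sumr_const card_ord -EFinM mulr_natl.
apply: lee_sum => i _; rewrite integral_dirac//; last first.
  apply/measurable_EFinP; apply: (measurableT_comp (measurable_powR _)) => //.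
  exact: measurable_fun_rho.
rewrite diracT mul1e lee_fin.
have -> : c0 = (c0 `^ p^-1) `^ p by rewrite -powRrM mulVf ?gt_eqF// powRr1// ltW.
apply: (ge0_ler_powR (ltW p0)); rewrite ?nnegrE ?powR_ge0 ?(rho_ge0 Hpol)//.
by rewrite (rhoC Hpol) ltW// xy.
Qed.

End lower_semicontinuity.

(** * Finite partitions into cells and the plan built on them *)

Lemma sum_over_classes {R : realFieldType} n k (q : nat -> nat) (h : nat -> R) :
  let N j : R := \sum_(i < n) (q i == j)%:R in
  (forall i, (q i <= k)%N) -> (forall j, (j <= k)%N -> N j = 0 -> h j = 0) ->
  \sum_(i < n) h (q i) / N (q i) = \sum_(j < k.+1) h j.
Proof.
move=> N qk h0.
(* A class [j] collects [N j] terms [h j / N j]; an empty one contributes nothing, which matches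
   [h j = 0]. *)
transitivity (\sum_(i < n) \sum_(j < k.+1) (q i == j)%:R * (h j / N j)).
  apply: eq_bigr => i _.
  have qk' : (q i < k.+1)%N by rewrite ltnS.
  rewrite (bigD1 (Ordinal qk'))//= eqxx mul1r big1 ?addr0// => j jq.
  case: eqP => [qj|]; last by rewrite mul0r.
  by exfalso; move/eqP: jq; apply; apply: val_inj; rewrite /= qj.
rewrite exchange_big/=; apply: eq_bigr => j _.
rewrite -mulr_suml -/(N j).
have [Nj|Nj] := eqVneq (N j) 0; last by rewrite mulrC divfK.
by rewrite Nj mul0r h0// -ltnS.
Qed.

Lemma integral_linear2 {R : realType} {d : measure_display} {T : measurableType d}
    (m : {measure set T -> \bar R}) (h1 h2 : T -> R) (a b I1 I2 : R) :
  (forall x, 0 <= h1 x) -> (forall x, 0 <= h2 x) ->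
  measurable_fun setT h1 -> measurable_fun setT h2 -> 0 <= a -> 0 <= b ->
  (\int[m]_x (h1 x)%:E = I1%:E)%E -> (\int[m]_x (h2 x)%:E = I2%:E)%E ->
  (\int[m]_x (a * h1 x + b * h2 x)%:E = (a * I1 + b * I2)%:E)%E.
Proof.
move=> h10 h20 mh1 mh2 a0 b0 E1 E2.
under eq_integral do rewrite EFinD 2!EFinM.
rewrite ge0_integralD//.
- rewrite !ge0_integralZl//; try exact/measurable_EFinP.
  + by rewrite E1 E2 -!EFinM -EFinD.
  + by move=> x _; rewrite lee_fin.
  + by move=> x _; rewrite lee_fin.
- by move=> x _; rewrite -EFinM lee_fin mulr_ge0.
- by apply: measurable_funeM; exact/measurable_EFinP.
- by move=> x _; rewrite -EFinM lee_fin mulr_ge0.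
- by apply: measurable_funeM; exact/measurable_EFinP.
Qed.

Section cell_transport.
Context {R : realType} {d : measure_display} {T : measurableType d} (rho : T -> T -> R).
Hypothesis Hpol : polish_borel rho.
Variables (p : R) (nu : probability T R) (x0 : T) (k : nat) (cell : T -> nat).
Hypothesis p0 : 0 < p.
Hypothesis cellk : forall x, (cell x <= k)%N.
Hypothesis mcell : forall j, measurable [set x | cell x = j].
Variables (e D M kap del : R).
Let G x := rho x0 x `^ p.
(** Cells below [k] have diameter at most [e]; cell [k] is the remainder, and [g] is the moment
    integrand restricted to it. *)
Let g x := \1_[set x | cell x = k] x * G x.
Hypothesis ME : (\int[nu]_x (G x)%:E = M%:E)%E.
Hypothesis kapE : (\int[nu]_x (g x)%:E = kap%:E)%E.
Hypothesis e0 : 0 <= e.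
Hypothesis celle : forall x u, cell x = cell u -> (cell x < k)%N -> rho x u <= e.
Hypothesis D0 : 0 <= D.
Hypothesis cellD : forall x, (cell x < k)%N -> G x <= D.
Hypothesis del01 : 0 < del < 1.

Let mG : measurable_fun setT G.
Proof.
by apply: (measurableT_comp (measurable_powR _)) => //; exact: measurable_fun_rho.
Qed.

Let mg : measurable_fun setT g.
Proof. by apply: measurable_funM => //. Qed.

Let G0 x : 0 <= G x. Proof. exact: powR_ge0. Qed.

Let g0 x : 0 <= g x. Proof. by rewrite mulr_ge0. Qed.

Let M0 : 0 <= M.
Proof. by rewrite -lee_fin -ME; apply: integral_ge0 => x _; rewrite lee_fin. Qed.

Let kap0 : 0 <= kap.
Proof. by rewrite -lee_fin -kapE; apply: integral_ge0 => x _; rewrite lee_fin. Qed.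

(* The mass of [nu] in each cell is spread, up to a factor [1 - del], evenly over the points
   of that cell; the missing mass of each point is taken from [nu] itself *)
Lemma cell_transport n (y : nat -> T) : (0 < n)%N ->
  (forall j, (j <= k)%N -> (1 - del) * fine (nu [set x | cell x = j]) * n%:R <=
     \sum_(i < n) (cell (y i) == j)%:R) ->
  exists sig : nat -> probability T R,
    (forall A, measurable A -> nu A = (n%:R^-1)%:E * \sum_(i < n) sig i A)%E /\
    ((n%:R^-1)%:E * \sum_(i < n) \int[sig i]_u (rho (y i) u `^ p)%:E <=
     (e `^ p + 2 `^ p * (2 * (n%:R^-1 * \sum_(i < n) g (y i)) + kap + del * (D + M)))%:E)%E.
Proof.
move=> n0 freq.
have /andP[del0 del1] := del01.
have nR0 : 0 < (n%:R : R) by rewrite ltr0n.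
pose C j := [set x | cell x = j].
pose v j := fine (nu (C j)).
pose q i := cell (y i).
pose N j : R := \sum_(i < n) (q i == j)%:R.
have v0 j : 0 <= v j by rewrite fine_ge0.
have N0 i : (i < n)%N -> 0 < N (q i).
  move=> ni; apply: (@lt_le_trans _ _ 1) => //.
  by rewrite /N (bigD1 (Ordinal ni))//= eqxx lerDl sumr_ge0.
have vN j : (j <= k)%N -> N j = 0 -> v j = 0.
  move=> jk Nj; apply/eqP; rewrite eq_le v0 andbT.
  have := freq j jk; rewrite -/(N j) Nj -/(v j) pmulr_lle0//.
  by rewrite pmulr_rle0// subr_gt0.
(* [N (q i)] sample points share the cell of [y i]; weight [al i] for each makes the average over
   all [n] points equal to [(1 - del) nu] on that cell. By [freq] the mass used is at most one, and
   [r i] is what is missing. *)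
pose al i := (1 - del) * n%:R / N (q i).
have al0 i : 0 <= al i.
  by rewrite divr_ge0 ?sumr_ge0// mulr_ge0// subr_ge0 ltW.
pose r i := 1 - al i * v (q i).
have alv i : (i < n)%N -> al i * v (q i) <= 1.
  move=> ni; rewrite /al mulrAC ler_pdivrMr ?N0// mul1r mulrAC.
  exact: freq (cellk _).
have r0 i : (i < n)%N -> 0 <= r i by move=> ni; rewrite subr_ge0 alv.
have r1 i : r i <= 1 by rewrite lerBlDr lerDl mulr_ge0.
pose s i u : R := al i * \1_(C (q i)) u + r i * cst 1 u.
have s0 i u : (i < n)%N -> 0 <= s i u.
  by move=> ni; rewrite addr_ge0// mulr_ge0 ?r0.
have ms i : measurable_fun setT (s i).
  apply: measurable_funD; apply: measurable_funM => //.
  by apply: measurable_indic; exact: mcell.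
have fE A : measurable A -> (fine (nu A))%:E = nu A.
  by move=> mA; rewrite fineK// fin_num_measure.
have IA A j : measurable A -> (\int[nu]_u (\1_(A `&` C j) u)%:E = (fine (nu (A `&` C j)))%:E)%E.
  move=> mA; have mAC : measurable (A `&` C j) by apply: measurableI => //; exact: mcell.
  by rewrite integral_indic// setIT fE.
have IA1 A : measurable A -> (\int[nu]_u (\1_A u)%:E = (fine (nu A))%:E)%E.
  by move=> mA; rewrite integral_indic// setIT fE.
have sA i A : (i < n)%N -> measurable A ->
    (\int[nu]_u (s i u * \1_A u)%:E =
     (al i * fine (nu (A `&` C (q i))) + r i * fine (nu A))%:E)%E.
  move=> ni mA; rewrite -(@integral_linear2 _ _ _ nu (\1_(A `&` C (q i))) (\1_A))//.
  - by apply: eq_integral => u _; rewrite /s indicI/=; congr EFin; ring.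
  - by apply: measurable_indic; apply: measurableI => //; exact: mcell.
  - exact: r0.
  - exact: IA.
  - exact: IA1.
have nuT : fine (nu setT) = 1 by rewrite probability_setT.
have s1 i : (i < n)%N -> (\int[nu]_u (s i u)%:E = 1)%E.
  move=> ni; transitivity (\int[nu]_u (s i u * \1_setT u)%:E)%E.
    by apply: eq_integral => u _; rewrite indicT mulr1.
  rewrite sA// setTI nuT mulr1 /r -/(v _); congr EFin; ring.
have /choice[sig Hsig] i : exists Q : probability T R, (i < n)%N ->
    (forall A, measurable A -> (Q A = \int[nu]_w (s i w * \1_A w)%:E)%E) /\
    (forall h : T -> R, (forall x, 0 <= h x) -> measurable_fun setT h ->
      (\int[Q]_x (h x)%:E = \int[nu]_w (s i w * h w)%:E)%E).
  have [ni|ni] := boolP (i < n)%N; last by exists nu.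
  have [Q HQ] := @weighted_law_probability R _ _ T T nu (s i) id
    (fun u => s0 i u ni) (ms i) (@measurable_id _ _ _) (s1 i ni).
  by exists Q.
have sum_cells A : measurable A ->
    \sum_(j < k.+1) fine (nu (A `&` C j)) = fine (nu A).
  move=> mA; apply: EFin_inj; rewrite -sumEFin -IA1//.
  under eq_bigr do rewrite -IA//.
  have /= := @integral_weighted_sum _ _ _ nu k.+1 1 (fun j => \1_(A `&` C j)) ler01.
  rewrite mul1e => ->//.
    apply: eq_integral => u _; congr EFin; rewrite mul1r.
    have uk : (cell u < k.+1)%N by rewrite ltnS.
    rewrite (bigD1 (Ordinal uk))//= indicI/= [X in _ * X]indicE mem_set// mulr1.
    rewrite big1 ?addr0// => j ju; rewrite indicI/= [X in _ * X]indicE memNset ?mulr0//=.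
    by move=> uj; move/eqP : ju; apply; apply: val_inj; rewrite /= uj.
  move=> j; apply: measurable_indic; apply: measurableI => //; exact: mcell.
have avg_al (h : nat -> R) : (forall j, (j <= k)%N -> N j = 0 -> h j = 0) ->
    n%:R^-1 * \sum_(i < n) al i * h (q i) = (1 - del) * \sum_(j < k.+1) h j.
  move=> h0; rewrite -(@sum_over_classes _ n k q h)//; last by move=> i; exact: cellk.
  rewrite !mulr_sumr; apply: eq_bigr => i _; rewrite /al -/(N _).
  have : N (q i) != 0 by rewrite gt_eqF// N0.
  move: (N (q i)) => Nq Nq0; field.
  by rewrite Nq0 gt_eqF.
(* Since the cells have total mass one, the missing masses average to exactly [del]; the average of
   the [sig i] is then [(1 - del) nu + del nu]. *)
have avg_r : n%:R^-1 * \sum_(i < n) r i = del.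
  rewrite sumrB mulrBr avg_al// sumr_const card_ord mulVf ?gt_eqF//.
  have -> : \sum_(j < k.+1) v j = 1.
    by rewrite -nuT -sum_cells//; apply: eq_bigr => j _; rewrite setTI.
  ring.
exists sig; split.
  move=> A mA.
  have -> : (\sum_(i < n) sig i A =
      (\sum_(i < n) (al i * fine (nu (A `&` C (q i))) + r i * fine (nu A)))%:E)%E.
    rewrite -sumEFin; apply: eq_bigr => i _.
    by have [HA _] := Hsig i (ltn_ord i); rewrite HA// sA.
  rewrite -EFinM -(fE A mA) big_split/= mulrDr (avg_al (fun j => fine (nu (A `&` C j)))).
    rewrite sum_cells// -mulr_suml mulrA avg_r; congr EFin; ring.
  move=> j jk Nj; have vj := vN j jk Nj.
  apply/eqP; rewrite eq_le fine_ge0// andbT -vj /v.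
  have mAC : measurable (A `&` C j) by apply: measurableI => //; exact: mcell.
  rewrite -lee_fin !fE//; last exact: mcell.
  by apply: le_measure; rewrite ?inE//; exact: mcell.
set avg := n%:R^-1 * \sum_(i < n) g (y i).
pose kk i : R := (q i == k)%:R.
(* The first three terms pay for the mass kept in the cell: [e^p] in a small cell, the moments of
   [y i] and of [nu] in cell [k]. The last term pays for the missing mass, using [G <= D + g] and
   [r i <= 1]. *)
pose B i := e `^ p + 2 `^ p * g (y i) + 2 `^ p * (al i * (kk i * kap))
  + 2 `^ p * (g (y i) + r i * (D + M)).
have costi i : (i < n)%N -> (\int[sig i]_u (rho (y i) u `^ p)%:E <= (B i)%:E)%E.
  move=> ni; have [_ HI] := Hsig i ni; rewrite HI; last 2 first.
  - by move=> u; exact: powR_ge0.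
  - by apply: (measurableT_comp (measurable_powR _)) => //; exact: measurable_fun_rho.
  pose c1 := al i * (e `^ p + 2 `^ p * g (y i)).
  pose c2 := 2 `^ p * al i * kk i.
  pose c3 := r i * 2 `^ p * G (y i).
  pose c4 := r i * 2 `^ p.
  have c10 : 0 <= c1 by rewrite mulr_ge0// addr_ge0 ?powR_ge0// mulr_ge0 ?powR_ge0.
  have c20 : 0 <= c2 by rewrite /c2 /kk; apply: mulr_ge0 => //; apply: mulr_ge0 => //; exact: powR_ge0.
  have c40 : 0 <= c4 by rewrite mulr_ge0 ?powR_ge0// r0.
  have c30 : 0 <= c3 by rewrite mulr_ge0.
  (* [U1] dominates the cost of the mass kept in the cell, [U2] that of the missing mass; wherever
     the cell gives no bound, the distance is estimated through [x0]. *)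
  pose U1 u := c1 * \1_(C (q i)) u + c2 * g u.
  pose U2 u := c3 * cst 1 u + c4 * G u.
  have IU1 : (\int[nu]_u (U1 u)%:E = (c1 * v (q i) + c2 * kap)%:E)%E.
    apply: integral_linear2 => //; first by apply: measurable_indic; exact: mcell.
    by rewrite IA1//; exact: mcell.
  have IU2 : (\int[nu]_u (U2 u)%:E = (c3 * 1 + c4 * M)%:E)%E.
    apply: integral_linear2 => //.
    apply: (etrans (@integral_cst _ _ _ nu setT measurableT 1%E)).
    by rewrite mul1e; exact: probability_setT.
  have U10 u : 0 <= U1 u by rewrite addr_ge0// mulr_ge0.
  have U20 u : 0 <= U2 u by rewrite addr_ge0// mulr_ge0.
  have mU1 : measurable_fun setT U1.
    apply: measurable_funD; apply: measurable_funM => //.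
    by apply: measurable_indic; exact: mcell.
  have mU2 : measurable_fun setT U2.
    by apply: measurable_funD; apply: measurable_funM.
  apply: (@le_trans _ _ (\int[nu]_u (1 * U1 u + 1 * U2 u)%:E)%E).
    apply: ge0_le_integral => //.
    - by move=> u _; rewrite lee_fin mulr_ge0 ?s0 ?powR_ge0.
    - apply/measurable_EFinP/measurable_funM => //.
      by apply: (measurableT_comp (measurable_powR _)) => //; exact: measurable_fun_rho.
    - by apply/measurable_EFinP/measurable_funD; apply: measurable_funM.
    move=> u _; rewrite lee_fin !mul1r.
    have tri : rho (y i) u `^ p <= 2 `^ p * G (y i) + 2 `^ p * G u.
      have := @powR_quasi_triangle _ p 1 (rho x0 (y i)) (rho x0 u) (ltW p0) ltr01
        (rho_ge0 Hpol _ _) (rho_ge0 Hpol _ _).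
      rewrite invr1; apply: le_trans.
      apply: (ge0_ler_powR (ltW p0)); rewrite ?nnegrE ?addr_ge0 ?(rho_ge0 Hpol)//.
      by rewrite (rhoC Hpol x0 (y i)); exact: (rho_triangle Hpol).
    rewrite /s mulrDl; apply: lerD; last first.
      rewrite /U2 /c3 /c4 /= !mulr1 -!mulrA -mulrDr; apply: ler_wpM2l => //; exact: r0.
    rewrite /U1 indicE.
    have [Cu|Cu] := pselect (C (q i) u); last first.
      by rewrite memNset//= mulr0 mul0r mulr0 add0r mulr_ge0.
    rewrite mem_set//= !mulr1.
    have -> : c1 + c2 * g u =
        al i * (e `^ p + 2 `^ p * g (y i) + 2 `^ p * (kk i * g u)).
      by rewrite /c1 /c2; ring.
    apply: ler_wpM2l => //.
    have [qk|qk] := ltnP (q i) k.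
      apply: (@le_trans _ _ (e `^ p)).
        apply: (ge0_ler_powR (ltW p0)); rewrite ?nnegrE ?(rho_ge0 Hpol)//.
        by apply: celle => //; rewrite Cu.
      by rewrite -addrA lerDl addr_ge0// !mulr_ge0 ?powR_ge0// /kk.
    have qE : q i = k by apply/eqP; rewrite eqn_leq qk andbT; exact: cellk.
    have gy : g (y i) = G (y i).
      by rewrite /g indicE mem_set ?mul1r.
    have gu : g u = G u.
      by rewrite /g indicE mem_set ?mul1r//=; rewrite -qE.
    rewrite gy gu /kk qE eqxx mul1r; apply: (le_trans tri).
    by rewrite -addrA lerDr powR_ge0.
  rewrite (@integral_linear2 _ _ _ nu U1 U2 1 1 _ _ U10 U20 mU1 mU2 ler01 ler01 IU1 IU2).
  rewrite lee_fin !mul1r mulr1 /B; apply: lerD.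
    apply: lerD.
      rewrite /c1 mulrAC -[leRHS]mul1r; apply: ler_wpM2r; last exact: alv.
      by rewrite addr_ge0 ?powR_ge0// mulr_ge0 ?powR_ge0.
    by rewrite /c2 -!mulrA.
  have GD : G (y i) <= D + g (y i).
    have [qk|qk] := ltnP (q i) k.
      by rewrite (le_trans (cellD qk))// lerDl.
    have qE : cell (y i) = k by apply/eqP; rewrite eqn_leq qk andbT; exact: cellk.
    by rewrite /g indicE mem_set// mul1r lerDr.
  have -> : c3 + c4 * M = 2 `^ p * (r i * (G (y i) + M)) by rewrite /c3 /c4; ring.
  apply: ler_wpM2l; first exact: powR_ge0.
  apply: (@le_trans _ _ (r i * (D + g (y i) + M))).
    by apply: ler_wpM2l; [exact: r0|rewrite lerD2r].
  have -> : r i * (D + g (y i) + M) = r i * g (y i) + r i * (D + M) by ring.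
  by rewrite lerD2r -[leRHS]mul1r ler_wpM2r.
apply: (@le_trans _ _ ((n%:R^-1)%:E * \sum_(i < n) (B i)%:E)%E).
  apply: lee_wpmul2l; first by rewrite lee_fin invr_ge0 ltW.
  by apply: lee_sum => i _; exact: costi.
rewrite sumEFin -EFinM lee_fin.
have kal : n%:R^-1 * \sum_(i < n) al i * (kk i * kap) <= kap.
  (* The factor [N j != 0] makes [h] vanish on empty classes, as [avg_al] demands; only [j = k]
     survives in the sum. *)
  pose h j : R := (j == k)%:R * ((N j != 0)%:R * kap).
  have -> : \sum_(i < n) al i * (kk i * kap) = \sum_(i < n) al i * h (q i).
    apply: eq_bigr => i _; congr *%R; rewrite /h /kk; congr *%R.
    by rewrite gt_eqF ?N0// mul1r.
  rewrite avg_al; last by move=> j _ Nj; rewrite /h Nj eqxx mul0r mulr0.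
  rewrite big_ord_recr/= big1 ?add0r; last first.
    by move=> j _; rewrite /h ltn_eqF// mul0r.
  rewrite /h eqxx mul1r mulrA -[leRHS]mul1r ler_wpM2r//.
  by case: (_ != _); rewrite ?mulr0// mulr1 lerBlDr lerDl ltW.
have -> : n%:R^-1 * \sum_(i < n) B i =
    e `^ p + 2 `^ p * avg + 2 `^ p * (n%:R^-1 * \sum_(i < n) al i * (kk i * kap))
    + 2 `^ p * (avg + del * (D + M)).
  rewrite /B !big_split/= sumr_const card_ord -!mulr_sumr big_split/= -mulr_suml.
  rewrite -avg_r /avg -mulr_natl.
  by field; rewrite gt_eqF.
have -> : e `^ p + 2 `^ p * (2 * avg + kap + del * (D + M)) =
   e `^ p + 2 `^ p * avg + 2 `^ p * kap + 2 `^ p * (avg + del * (D + M)) by ring.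
by rewrite lerD2r lerD2l ler_wpM2l// powR_ge0.
Qed.

End cell_transport.

(* Equal to [k] when [x] belongs to none of [B 0, ..., B k.-1] *)
Fixpoint first_index {T : Type} (B : nat -> set T) (k : nat) (x : T) : nat :=
  if k is k'.+1 then
    let c := first_index B k' x in
    if (c < k')%N then c else if `[< B k' x >] then k' else k
  else 0%N.

Section first_index.
Context {T : Type} (B : nat -> set T).

Lemma first_index_le k x : (first_index B k x <= k)%N.
Proof. by elim: k => //= k IH; case: ifP => [/ltnW/leqW//|_]; case: ifP. Qed.

Lemma first_index_in k x : (first_index B k x < k)%N -> B (first_index B k x) x.
Proof.
elim: k => //= k IH; case: ifP => [/IH//|_]; case: ifPn => [/asboolP//|_].
by rewrite ltnn.
Qed.

Lemma first_index_notin k x j : first_index B k x = k -> (j < k)%N -> ~ B j x.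
Proof.
elim: k => //= k IH; case: ifP => [ck ckE|/negbT].
  by rewrite ckE ltnNge leqnSn in ck.
rewrite -leqNgt => kc; case: ifPn => [_ /n_Sn//|/asboolPn nB _].
rewrite ltnS leq_eqVlt => /predU1P[->//|jk]; apply: IH => //.
by apply/eqP; rewrite eqn_leq first_index_le.
Qed.

End first_index.

Lemma measurable_first_index {d} {T : measurableType d} (B : nat -> set T) k j :
  (forall i, measurable (B i)) -> measurable [set x | first_index B k x = j].
Proof.
move=> mB; elim: k j => [|k IH] j /=.
  have [->|j0] := eqVneq j 0%N.
    by rewrite (_ : [set _ | _] = setT) //; apply/seteqP; split.
  rewrite (_ : [set _ | _] = set0) //; apply/seteqP; split => // x /= /esym/eqP.
  by rewrite (negPf j0).
have fk x : (first_index B k x < k)%N = false <-> first_index B k x = k.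
  split => [/negbT|->]; last by rewrite ltnn.
  by rewrite -leqNgt => kc; apply/eqP; rewrite eqn_leq first_index_le.
(* Passing to [k.+1] leaves the level sets below [k] unchanged and splits the level set [k] by
   [B k]: inside the value stays [k], outside it becomes [k.+1]. *)
have [jk|jk|->] := ltngtP j k.
- rewrite (_ : [set _ | _] = [set x | first_index B k x = j]) //.
  apply/seteqP; split => x /=.
    by case: ifP => // /fk ck; case: ifP => _ kj; move: jk; rewrite -kj ?ltnn// ltnNge leqnSn.
  by move=> ->; rewrite jk.
- have [->|jk1] := eqVneq j k.+1.
    rewrite (_ : [set _ | _] = [set x | first_index B k x = k] `\` B k).
      by apply: measurableD.
    apply/seteqP; split => x /=.
      case: ifP => [ck ckE|/fk ck]; first by rewrite ckE ltnNge leqnSn in ck.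
      by case: ifPn => [_ /n_Sn//|/asboolPn].
    by move=> [-> nB]; rewrite ltnn ifN//; exact/asboolPn.
  rewrite (_ : [set _ | _] = set0) //; apply/seteqP; split => // x /=.
  have := first_index_le B k.+1 x => /= /[swap] -> jk'.
  by move: jk1; rewrite eqn_leq jk' jk.
- rewrite (_ : [set _ | _] = [set x | first_index B k x = k] `&` B k).
    by apply: measurableI.
  apply/seteqP; split => x /=.
    case: ifP => [ck ckE|/fk ck]; first by rewrite ckE ltnn in ck.
    by case: ifPn => [/asboolP|_ /esym/n_Sn].
  by move=> [-> BK]; rewrite ltnn ifT//; exact/asboolP.
Qed.

(** The cells are the balls of radius [e / 2] around the first [k] dense points, made disjoint, and
    the remainder. Each point leaves the remainder as [k] grows, so its moment tends to zero by
    dominated convergence. *)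
Lemma exists_cells {R : realType} {d : measure_display} {T : measurableType d}
    (rho : T -> T -> R) (p : R) (nu : probability T R) (x0 : T) (e kap0 : R) :
  polish_borel rho -> 0 < p -> 0 < e -> 0 < kap0 ->
  (\int[nu]_x ((rho x0 x) `^ p)%:E < +oo)%E ->
  exists (k : nat) (cell : T -> nat) (D kap : R),
    [/\ forall x, (cell x <= k)%N,
        forall j, measurable [set x | cell x = j],
        forall x u, cell x = cell u -> (cell x < k)%N -> rho x u <= e,
        0 <= D /\ forall x, (cell x < k)%N -> rho x0 x `^ p <= D &
        kap < kap0 /\
        (\int[nu]_x (\1_[set x | cell x = k] x * rho x0 x `^ p)%:E = kap%:E)%E].
Proof.
move=> Hpol p0 e0 kap00 fin.
have [a Ha] := dense_sequence Hpol.
have e2 : 0 < e / 2 by rewrite divr_gt0.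
pose B j := [set x | rho (a j) x < e / 2].
have mB j : measurable (B j).
  rewrite (_ : B j = rho (a j) @^-1` `]-oo, e / 2[).
    by rewrite -[X in measurable X]setTI; exact: measurable_fun_rho.
  by apply/seteqP; split => x /=; rewrite in_itv.
pose G x := rho x0 x `^ p.
have G0 x : 0 <= G x by exact: powR_ge0.
have mG : measurable_fun setT G.
  by apply: (measurableT_comp (measurable_powR _)) => //; exact: measurable_fun_rho.
pose g k x := \1_[set x | first_index B k x = k] x * G x.
have g0 k x : 0 <= g k x by rewrite mulr_ge0.
have mg k : measurable_fun setT (g k).
  apply: measurable_funM => //; apply: measurable_indic.
  exact: measurable_first_index.
have gG k x : g k x <= G x.
  by rewrite /g -[leRHS]mul1r ler_wpM2r.
have cvg0 : (\int[nu]_x (g k x)%:E @[k --> \oo] --> \int[nu]_x (cst 0 x))%E.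
  apply: (@dominated_cvg _ _ _ nu setT measurableT (fun k x => (g k x)%:E) (cst 0%E) (EFin \o G)) => //.
  - by move=> k; exact/measurable_EFinP.
  - move=> x _; have [j aj] := Ha x _ e2.
    apply: cvg_near_cst; exists j.+1 => // k /= jk.
    rewrite /g indicE memNset ?mul0r//= => ck; exact: (@first_index_notin _ B k x j ck jk aj).
  - apply/integrableP; split; first exact/measurable_EFinP.
    by under eq_integral => x _ do rewrite /= ger0_norm//.
  - by move=> k x _; rewrite /= lee_fin ger0_norm.
rewrite integral0 in cvg0.
have [k _ kP] : \forall k \near \oo, (\int[nu]_x (g k x)%:E < kap0%:E)%E.
  apply: (cvg0 [set y | (y < kap0%:E)%E]); apply: open_nbhs_nbhs; split.
    exact: open_ereal_lt_ereal.
  by rewrite /= lte_fin.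
have {kP} kP := kP k (leqnn k).
have gfin : (\int[nu]_x (g k x)%:E)%E \is a fin_num.
  rewrite ge0_fin_numE ?(lt_trans kP) ?ltry//.
  by apply: integral_ge0 => x _; rewrite lee_fin.
(* The sum stands in for a maximum: on cell [j] the single term [(rho x0 (a j) + e)^p] already
   bounds the integrand. *)
exists k, (first_index B k), (\sum_(j < k) (rho x0 (a j) + e) `^ p),
  (fine (\int[nu]_x (g k x)%:E)); split.
- exact: first_index_le.
- by move=> j; exact: measurable_first_index.
- move=> x u xu xk; have := first_index_in xk; have := first_index_in (B := B) (k := k) (x := u).
  rewrite -xu => /(_ xk); rewrite /B /= => au ax.
  have := rho_triangle Hpol x (a (first_index B k x)) u.
  by rewrite (rhoC Hpol x (a _)); move: (first_index _ _ _) au ax => c; lra.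
- split; first by rewrite sumr_ge0// => j _; exact: powR_ge0.
  move=> x xk; have ax := first_index_in xk.
  rewrite (bigD1 (Ordinal xk))//=; apply: (@le_trans _ _ ((rho x0 (a (first_index B k x)) + e) `^ p)).
    apply: (ge0_ler_powR (ltW p0)); rewrite ?nnegrE ?addr_ge0 ?(rho_ge0 Hpol)//.
      exact: ltW.
    have := rho_triangle Hpol x0 (a (first_index B k x)) x.
    by move: ax; rewrite /B /=; move: (first_index _ _ _) => c; lra.
  by rewrite lerDl sumr_ge0// => j _; exact: powR_ge0.
- by rewrite -lte_fin fineK.
Qed.

(** * Deviation bounds for samples of law [nu] *)

Section iid_under.
Context {R : realType} {dO d : measure_display} {Omega : measurableType dO}
  {T : measurableType d} (X : nat -> Omega -> T) (nu : probability T R).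
Hypothesis mX : forall i, measurable_fun setT (X i).

(** Independence is phrased with test functions, the form in which [change_of_law] provides it. *)
Definition iid_upto n (Q : probability Omega R) : Prop :=
  forall (psi : nat -> T -> R) (c : nat -> R),
    (forall i x, 0 <= psi i x) -> (forall i, measurable_fun setT (psi i)) ->
    (forall i, \int[nu]_x (psi i x)%:E = (c i)%:E)%E ->
    (\int[Q]_w (\prod_(i < n) psi i (X i w))%:E = (\prod_(i < n) c i)%:E)%E.

(* Chernoff's bound with parameter [del]: it works since [del * (1 - del) < 1 - exp (- del)] *)
Lemma low_frequency (A : set T) (del : R) : measurable A -> 0 < del < 1 ->
  exists q : R, [/\ 0 <= q, q < 1 & forall n Q, (0 < n)%N -> iid_upto n Q ->
    (Q [set w | (\sum_(i < n) \1_A (X i w) < (1 - del) * fine (nu A) * n%:R)%R]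
      <= (q ^+ n)%:E)%E].
Proof.
move=> mA /andP[del0 del1].
pose v := fine (nu A).
have v0 : 0 <= v by rewrite fine_ge0.
have vE : nu A = v%:E by rewrite fineK// fin_num_measure.
have [v_gt0|v_le0] := ltP 0 v; last first.
  exists 0; split => // n Q n0 _.
  rewrite (_ : [set _ | _] = set0) ?measure0 ?lee_fin ?exprn_ge0//.
  apply/seteqP; split => // w /=; rewrite -/v.
  have -> : v = 0 by apply/eqP; rewrite eq_le v_le0.
  by rewrite mulr0 mul0r ltNge sumr_ge0.
(* [b1] and [b2] are the values on [A] and off [A] of [exp (del * ((1 - del) v - \1_A))]. The
   product of these factors over the sample is at least one on the event, so the event has
   probability at most [q ^+ n]. *)
pose b1 := expR (del * ((1 - del) * v - 1)).
pose b2 := expR (del * ((1 - del) * v)).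
pose psi x := b1 * \1_A x + b2 * \1_(~` A) x.
have mAC : measurable (~` A) by exact: measurableC.
have psi0 x : 0 <= psi x by rewrite addr_ge0// mulr_ge0 ?expR_ge0.
have mpsi : measurable_fun setT psi.
  by apply: measurable_funD; apply: measurable_funM => //; apply: measurable_indic.
have psiE x : psi x = expR (del * ((1 - del) * v - \1_A x)).
  rewrite /psi !indicE; have [Ax|Ax] := pselect (A x).
    by rewrite mem_set// memNset ?mulr0 ?addr0 ?mulr1//= => /(_ Ax).
  by rewrite memNset// mem_set ?mulr0 ?add0r ?mulr1 ?subr0.
pose q := b1 * v + b2 * (1 - v).
have psiI : (\int[nu]_x (psi x)%:E = q%:E)%E.
  apply: integral_linear2 => //; try exact: measurable_indic; try exact: expR_ge0.
    by rewrite integral_indic// setIT.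
  rewrite integral_indic// setIT.
  apply: (etrans (probability_setC nu mA)); rewrite [X in (_ - X)%E]vE EFinB //.
have q0 : 0 <= q by rewrite -lee_fin -psiI; apply: integral_ge0 => x _; rewrite lee_fin.
exists q; split => //.
  have -> : q = b2 * (1 - v * (1 - expR (- del))).
    rewrite /q /b1 /b2 mulrBr mulr1 expRD; ring.
  apply: (@le_lt_trans _ _ (b2 * expR (- (v * (1 - expR (- del)))))).
    by rewrite ler_wpM2l ?expR_ge0//; exact: expR_ge1Dx.
  rewrite /b2 -expRD -[ltRHS]expR0 ltr_expR.
  have e1 : expR (- del) * (1 + del) <= 1.
    rewrite expRN mulrC ler_pdivrMr ?expR_gt0// mul1r; exact: expR_ge1Dx.
  (* From [exp (- del) <= 1 / (1 + del)] and [(1 - del + del^2) (1 + del) = 1 + del^3 > 1]. *)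
  have : expR (- del) < 1 - del * (1 - del).
    rewrite -(@ltr_pM2r _ (1 + del)); last by rewrite addr_gt0.
    apply: (le_lt_trans e1).
    have : 0 < del ^+ 3 by rewrite exprn_gt0.
    by rewrite -subr_gt0 => h; rewrite -subr_gt0; move: h; rewrite subr0; congr (0 < _); ring.
  move: (expR (- del)) => z Hz.
  rewrite [ltLHS](_ : _ = v * (z - (1 - del * (1 - del)))); last by ring.
  by rewrite pmulr_rlt0// subr_lt0.
move=> n Q n0 iidQ.
have mS : measurable_fun setT (fun w => \sum_(i < n) \1_A (X i w) : R).
  by apply: measurable_sum => i; apply: measurableT_comp => //; exact: measurable_indic.
set E := [set w | _].
have mE : measurable E.
  rewrite (_ : E = (fun w => \sum_(i < n) \1_A (X i w) : R) @^-1` `]-oo, (1 - del) * v * n%:R[).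
    by rewrite -[X in measurable X]setTI; exact: mS.
  by apply/seteqP; split => w /=; rewrite in_itv.
have <- : (\int[Q]_w (\prod_(i < n) psi (X i w))%:E = (q ^+ n)%:E)%E.
  by rewrite (iidQ (fun=> psi) (fun=> q))// prodr_const card_ord.
rewrite -[E]setIT -integral_indic//; apply: ge0_le_integral => //.
- apply/measurable_EFinP; exact: measurable_indic.
- by apply/measurable_EFinP; apply: measurable_prod => i _; apply: measurableT_comp.
move=> w _; rewrite lee_fin indicE.
have [Ew|Ew] := pselect (E w); last by rewrite memNset// prodr_ge0.
rewrite mem_set//; under eq_bigr do rewrite psiE.
rewrite -expR_sum -[leLHS]expR0 ler_expR -mulr_sumr mulr_ge0 ?ltW//.
rewrite sumrB sumr_const card_ord subr_gt0 -mulr_natr; exact: Ew.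
Qed.

Lemma iid_upto_integral_sum (g : T -> R) (kap : R) n (Q : probability Omega R) :
  (forall x, 0 <= g x) -> measurable_fun setT g ->
  (\int[nu]_x (g x)%:E = kap%:E)%E -> iid_upto n Q ->
  (\int[Q]_w (\sum_(i < n) g (X i w))%:E = (n%:R * kap)%:E)%E.
Proof.
move=> g0 mg gE iidQ.
have Igi i : (i < n)%N -> (\int[Q]_w (g (X i w))%:E = kap%:E)%E.
  move=> ni; pose i' := Ordinal ni.
  (* Setting all other factors to one extracts the law of a single coordinate from the product
     formula. *)
  have := iidQ (fun j => if j == i then g else cst 1) (fun j => if j == i then kap else 1).
  rewrite (bigD1 i')//= eqxx big1 ?mulr1; last first.
    by move=> j ji; rewrite ifN.
  move=> <-.
  - apply: eq_integral => w _; rewrite (bigD1 i')//= eqxx big1 ?mulr1// => j ji.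
    by rewrite ifN.
  - by move=> j x; case: ifP.
  - by move=> j; case: ifP.
  - move=> j; case: ifP => // _.
    apply: (etrans (@integral_cst _ _ _ nu setT measurableT 1%E)).
    by rewrite mul1e; exact: probability_setT.
under eq_integral do rewrite -[X in X%:E]mul1r.
rewrite -(@integral_weighted_sum _ _ _ Q n _ (fun i w => g (X i w)))//; last first.
  by move=> i; exact: measurableT_comp.
rewrite (eq_bigr (fun=> kap%:E)); last by move=> i _; exact: Igi.
by rewrite mul1e sumEFin sumr_const card_ord -[kap *+ n]mulr_natl.
Qed.

(** Markov's inequality; the empirical mean of [g] has expectation [kap]. *)
Lemma high_average (g : T -> R) (kap c : R) n (Q : probability Omega R) :
  (forall x, 0 <= g x) -> measurable_fun setT g ->
  (\int[nu]_x (g x)%:E = kap%:E)%E -> 0 < c -> (0 < n)%N -> iid_upto n Q ->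
  (Q [set w | (c < n%:R^-1 * \sum_(i < n) g (X i w))%R] <= (kap / c)%:E)%E.
Proof.
move=> g0 mg gE c0 n0 iidQ.
pose S w := n%:R^-1 * \sum_(i < n) g (X i w).
have mS : measurable_fun setT S.
  apply: measurable_funM => //; apply: measurable_sum => i.
  exact: measurableT_comp.
have S0 w : 0 <= S w by rewrite mulr_ge0 ?invr_ge0// sumr_ge0.
have SI : (\int[Q]_w (S w)%:E = kap%:E)%E.
  under eq_integral do rewrite EFinM.
  rewrite ge0_integralZl//.
  - rewrite (@iid_upto_integral_sum g kap)// -EFinM mulKf//.
    by rewrite pnatr_eq0 -lt0n.
  - apply/measurable_EFinP; apply: measurable_sum => i.
    exact: measurableT_comp.
  - by move=> w _; rewrite lee_fin sumr_ge0.
set E := [set w | _].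
have mE : measurable E.
  rewrite (_ : E = S @^-1` `]c, +oo[).
    by rewrite -[X in measurable X]setTI; exact: mS.
  by apply/seteqP; split => w /=; rewrite in_itv/= andbT.
rewrite EFinM lee_pdivlMr// muleC -SI.
rewrite -[E]setIT -integral_indic// -ge0_integralZl//.
- apply: ge0_le_integral => //.
  + by move=> w _; rewrite -EFinM lee_fin mulr_ge0// ltW.
  + by apply: measurable_funeM; apply/measurable_EFinP; exact: measurable_indic.
  + exact/measurable_EFinP.
  move=> w _; rewrite -EFinM lee_fin indicE.
  have [Ew|Ew] := pselect (E w); last by rewrite memNset// mulr0.
  by rewrite mem_set// mulr1 ltW.
- apply/measurable_EFinP; exact: measurable_indic.
- by rewrite lee_fin ltW.
Qed.

End iid_under.

(** * The entropy inequality *)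

Lemma xlnx_le1 {R : realType} (x : R) : 0 <= x -> - (x * ln x) <= 1.
Proof.
rewrite le_eqVlt => /predU1P[<-|x0]; first by rewrite mul0r oppr0.
have := @expR_ge1Dx R (- ln x); rewrite expRN lnK ?posrE// => H.
have : x * (1 - ln x) <= x * x^-1 by rewrite ler_wpM2l// ltW.
rewrite divff ?gt_eqF// mulrBr mulr1; lra.
Qed.

Section entropy_bound.
Context {R : realType} {dO d : measure_display} {Omega : measurableType dO}
  {T : measurableType d} (P : probability Omega R) (X : nat -> Omega -> T)
  (mu nu : probability T R) (f : T -> R).
Hypotheses (iidX : iid_law P X mu) (fdens : density_of nu mu f).

Let hp x : R := Num.max (ln (f x)) 0.
Let hm x : R := Num.max (- ln (f x)) 0.

Let hp0 x : 0 <= hp x. Proof. by rewrite le_max lexx orbT. Qed.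
Let hm0 x : 0 <= hm x. Proof. by rewrite le_max lexx orbT. Qed.

Let hE x : ln (f x) = hp x - hm x.
Proof.
rewrite /hp /hm; have [l0|l0] := leP 0 (ln (f x)).
  by rewrite (max_idPr _) ?subr0// oppr_le0.
by rewrite (max_idPl _) ?sub0r ?opprK// oppr_ge0 ltW.
Qed.

Let mln : measurable_fun setT (fun x => ln (f x)).
Proof. by case: fdens => mf _ _; apply: measurableT_comp => //; exact: measurable_ln. Qed.

Let mhp : measurable_fun setT hp.
Proof. by apply: measurable_maxr => //; exact: measurable_cst. Qed.

Let mhm : measurable_fun setT hm.
Proof.
by apply: measurable_maxr => //; exact: measurableT_comp.
Qed.

Lemma entropy_integralE :
  (\int[nu]_x (ln (f x))%:E = \int[nu]_x (hp x)%:E - \int[nu]_x (hm x)%:E)%E.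
Proof.
rewrite integralE; congr (_ - _)%E; apply: eq_integral => x _.
  by rewrite funeposE -EFin_max.
by rewrite funenegE -EFinN -EFin_max.
Qed.

(** Against [mu] the integrand is [max (- f ln f) 0], which is at most one. Hence the integral of
    [ln f] is never an indeterminate difference of infinities. *)
Lemma entropy_neg_part_le1 : (\int[nu]_x (hm x)%:E <= 1)%E.
Proof.
have [mf f0 _] := fdens.
rewrite (integral_density fdens)//.
apply: (@le_trans _ _ (\int[mu]_x (cst 1 x))%E); last first.
  by rewrite integral_cst// mul1e; exact: probability_le1.
apply: ge0_le_integral => //.
- by move=> x _; rewrite lee_fin mulr_ge0.
- by apply/measurable_EFinP/measurable_funM.
move=> x _; rewrite lee_fin /hm maxr_pMr// mulr0 ge_max ler01 andbT mulrN.
exact: xlnx_le1.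
Qed.

(* With [F] the density of [Q], integrate the pointwise bound
   [F * (1 + c * \1_A - ln F) <= exp (c * \1_A) <= exp c * \1_A + 1] *)
Lemma entropy_bound n (Q : probability Omega R) (A : set Omega) (c I J : R) :
  (forall g : Omega -> R, (forall w, 0 <= g w) -> measurable_fun setT g ->
    (\int[Q]_w (g w)%:E = \int[P]_w ((\prod_(i < n) f (X i w)) * g w)%:E)%E) ->
  iid_upto X nu n Q -> measurable A -> 0 <= c ->
  (\int[nu]_x (hp x)%:E = I%:E)%E -> (\int[nu]_x (hm x)%:E = J%:E)%E ->
  c * fine (Q A) - n%:R * (I - J) <= expR c * fine (P A).
Proof.
move=> QE iidQ mA c0 IE JE.
have ge01 : 0 <= 1 :> R by exact: ler01.
have [mf f0 _] := fdens.
have mX i : measurable_fun setT (X i) by case: iidX.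
pose F w := \prod_(i < n) f (X i w).
have F0 w : 0 <= F w by apply: prodr_ge0.
have mF : measurable_fun setT F.
  by apply: measurable_prod => i _; apply: measurableT_comp.
pose Sp w := \sum_(i < n) hp (X i w).
pose Sm w := \sum_(i < n) hm (X i w).
have Sp0 w : 0 <= Sp w by apply: sumr_ge0.
have Sm0 w : 0 <= Sm w by apply: sumr_ge0.
have mSp : measurable_fun setT Sp by apply: measurable_sum => i; apply: measurableT_comp.
have mSm : measurable_fun setT Sm by apply: measurable_sum => i; apply: measurableT_comp.
have mind : measurable_fun setT (\1_A : Omega -> R) by exact: measurable_indic.
have I1 (m : probability Omega R) : (\int[m]_w (cst 1 w)%:E = 1%:E)%E.
  apply: (etrans (@integral_cst _ _ _ m setT measurableT 1%E)).
  by rewrite mul1e; exact: probability_setT.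
have IA (m : probability Omega R) : (\int[m]_w (\1_A w)%:E = (fine (m A))%:E)%E.
  by rewrite integral_indic// setIT fineK// fin_num_measure.
pose U w := 1 * cst 1 w + c * \1_A w.
have U0 w : 0 <= U w by rewrite addr_ge0// mulr_ge0.
have mU : measurable_fun setT U by apply: measurable_funD; apply: measurable_funM.
have UI : (\int[Q]_w (U w)%:E = (1 * 1 + c * fine (Q A))%:E)%E.
  apply: (@integral_linear2 _ _ _ Q (cst 1) \1_A) => //; [exact: I1|exact: IA].
(* The negative part of [ln F] joins the left side and the positive part the right side, so that
   only non-negative functions are integrated. *)
pose V w := 1 * U w + 1 * Sm w.
have V0 w : 0 <= V w by rewrite addr_ge0// mulr_ge0.
have mV : measurable_fun setT V by apply: measurable_funD; apply: measurable_funM.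
have VI : (\int[Q]_w (V w)%:E =
    (1 * (1 * 1 + c * fine (Q A)) + 1 * (n%:R * J))%:E)%E.
  apply: (@integral_linear2 _ _ _ Q U Sm) => //; exact: (iid_upto_integral_sum mX hm0 mhm JE iidQ).
pose W w := expR c * \1_A w + 1 * cst 1 w.
have W0 w : 0 <= W w by rewrite addr_ge0// mulr_ge0 ?expR_ge0.
have mW : measurable_fun setT W by apply: measurable_funD; apply: measurable_funM.
have WI : (\int[P]_w (W w)%:E = (expR c * fine (P A) + 1 * 1)%:E)%E.
  apply: (@integral_linear2 _ _ _ P \1_A (cst 1)) => //; rewrite ?expR_ge0//.
    exact: IA.
  exact: I1.
pose Z w := 1 * W w + 1 * (F w * Sp w).
have Z0 w : 0 <= Z w by rewrite addr_ge0// mul1r// mulr_ge0.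
have ZI : (\int[P]_w (Z w)%:E =
    (1 * (expR c * fine (P A) + 1 * 1) + 1 * (n%:R * I))%:E)%E.
  apply: (@integral_linear2 _ _ _ P W (fun w => F w * Sp w)) => //.
  - by move=> w; rewrite mulr_ge0.
  - exact: measurable_funM.
  - by rewrite -(QE Sp)//; exact: (iid_upto_integral_sum mX hp0 mhp IE iidQ).
have : (\int[P]_w (F w * V w)%:E <= \int[P]_w (Z w)%:E)%E.
  apply: ge0_le_integral => //.
  - by move=> w _; rewrite lee_fin mulr_ge0.
  - by apply/measurable_EFinP/measurable_funM.
  - apply/measurable_EFinP/measurable_funD; apply: measurable_funM => //.
    exact: measurable_funM.
  move=> w _; rewrite lee_fin /Z /V /U /W /= !mul1r.
  (* Where [F] vanishes, [ln] takes a default value and [exp] does not recover [F]; there the left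
     side is zero. *)
  have [F_eq0|F_neq0] := eqVneq (F w) 0.
    by rewrite F_eq0 !mul0r addr0 addr_ge0// mulr_ge0 ?expR_ge0.
  have F_gt0 : 0 < F w by rewrite lt_neqAle eq_sym F_neq0 F0.
  have f_gt0 (i : 'I_n) : 0 < f (X i w).
    rewrite lt_neqAle eq_sym f0 andbT; apply: contra_neq F_neq0 => fi0.
    by rewrite /F (bigD1 i)//= fi0 mul0r.
  have lnF : expR (Sp w - Sm w) = F w.
    rewrite /Sp /Sm -sumrB expR_sum; apply: eq_bigr => i _.
    by rewrite -hE lnK ?posrE.
  (* This is [1 + z <= exp z] at [z = c * \1_A - ln F], multiplied by [F]. *)
  have key : F w * (1 + (c * \1_A w - (Sp w - Sm w))) <= expR (c * \1_A w).
    rewrite -ler_pdivlMl//; apply: (le_trans (expR_ge1Dx _)).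
    by rewrite expRD expRN lnF mulrC.
  have eA : expR (c * \1_A w) <= expR c * \1_A w + 1.
    rewrite indicE; case: (w \in A); rewrite ?mulr1 ?mulr0 ?expR0 ?add0r ?lexx//.
    by rewrite lerDl.
  have := le_trans key eA.
  have -> : F w * (1 + (c * \1_A w - (Sp w - Sm w))) =
    F w * (1 + c * \1_A w + Sm w) - F w * Sp w by ring.
  by rewrite lerBlDr.
rewrite -QE// VI ZI lee_fin; lra.
Qed.

End entropy_bound.

(** * Closeness of the empirical measure to [nu] *)

Section empirical_far.
Context {R : realType} {d : measure_display} {T : measurableType d} (rho : T -> T -> R).
Hypothesis Hpol : polish_borel rho.
Variables (p : R) (mu nu : probability T R).
Hypotheses (p0 : 0 < p) (nuP : finite_pmoment rho p nu).
Context {dO : measure_display} {Omega : measurableType dO} (X : nat -> Omega -> T).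
Hypothesis mX : forall i, measurable_fun setT (X i).

Lemma empirical_far (t eta : R) : 0 <= t -> 0 < eta ->
  (t%:E < Wdist rho p nu mu)%E ->
  \forall n \near \oo, forall Q : probability Omega R, iid_upto X nu n Q ->
    1 - eta <= fine (Q [set w | (t%:E < Wdist rho p (empirical X n w) mu)%E]).
Proof.
move=> t0 eta0; rewrite lt_Wdist// => /(Tcost_lsc Hpol p0 (powR_ge0 _ _))[c0 c00 Hc0].
have [x0 fin] := nuP.
pose G x := rho x0 x `^ p.
have G0 x : 0 <= G x by exact: powR_ge0.
have mG : measurable_fun setT G.
  by apply: (measurableT_comp (measurable_powR _)) => //; exact: measurable_fun_rho.
pose M := fine (\int[nu]_x (G x)%:E)%E.
have ME : (\int[nu]_x (G x)%:E = M%:E)%E.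
  by rewrite fineK// ge0_fin_numE// integral_ge0// => x _; rewrite lee_fin.
have M0 : 0 <= M by rewrite fine_ge0// integral_ge0// => x _; rewrite lee_fin.
pose K : R := 2 `^ p.
have K0 : 0 < K by exact: powR_gt0.
(* The budget [c0] is split into four equal parts: the cell diameter, the sample moment in the
   remainder (at most [c1] on average), its [nu]-moment [kap], and the missing mass. *)
pose e := (c0 / 4) `^ p^-1.
have e0 : 0 < e by rewrite powR_gt0// divr_gt0.
have eE : e `^ p = c0 / 4.
  by rewrite /e -powRrM mulVf ?gt_eqF// powRr1// divr_ge0// ltW.
pose c1 := c0 / 4 / K / 2.
have c10 : 0 < c1 by rewrite !divr_gt0.
(* The second bound makes Markov's estimate [kap / c1] smaller than [eta / 2]. *)
pose kap0 := Num.min (c0 / 4 / K) (c1 * (eta / 2)).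
have kap00 : 0 < kap0 by rewrite lt_min !divr_gt0// mulr_gt0// divr_gt0.
have [k [cell [D [kap [cellk mcell celle [D0 cellD] [kaplt kapE]]]]]] :=
  exists_cells Hpol p0 e0 kap00 fin.
move: kaplt; rewrite lt_min => /andP[kaplt1 kaplt2].
have MD0 : 0 < D + M + 1 := ltr_wpDl (addr_ge0 D0 M0) ltr01.
pose del := Num.min (1 / 2) (c0 / 4 / K / (D + M + 1)).
have del0 : 0 < del by rewrite lt_min !divr_gt0.
have del1 : del < 1.
  have : del <= 1 / 2 by rewrite /del ge_min lexx.
  lra.
have delK : K * (del * (D + M)) <= c0 / 4.
  have h : del <= c0 / 4 / K / (D + M + 1) by rewrite /del ge_min lexx orbT.
  have : del * (D + M + 1) <= c0 / 4 / K by rewrite -ler_pdivlMr.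
  rewrite ler_pdivlMr// => h2; apply: le_trans h2; rewrite mulrC.
  by apply: ler_wpM2r; [exact: ltW|rewrite ler_pM2l// lerDl].
pose g x := \1_[set x | cell x = k] x * G x.
have g0 x : 0 <= g x by rewrite mulr_ge0.
have mg : measurable_fun setT g by apply: measurable_funM => //; exact: measurable_indic.
pose C j := [set x | cell x = j].
have del01 : 0 < del < 1 by rewrite del0.
(* The number of cells is fixed before [n], so the [k.+1] geometric bounds add up to less than
   [eta / 2] for large [n]. *)
have /choice[q Hq] (j : nat) := low_frequency nu mX (mcell j) del01.
have cvgq m : \sum_(j < m) q j ^+ n @[n --> \oo] --> (0 : R).
  elim: m => [|m IHm].
    by under eq_fun do rewrite big_ord0; exact: cvg_cst.
  under eq_fun do rewrite big_ord_recr/=.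
  have qm : `|q m| < 1 by have [qm0 qm1 _] := Hq m; rewrite ger0_norm.
  by have /(_ _) := cvgD IHm (cvg_expr qm); rewrite addr0; apply.
have eta2 : 0 < eta / 2 by rewrite divr_gt0.
have small : \forall n \near \oo, \sum_(j < k.+1) q j ^+ n < eta / 2.
  exact: (cvgr_lt _ (cvgq k.+1)).
near=> n.
move=> Q iidQ.
have n0 : (0 < n)%N by near: n; exists 1%N.
have smalln : \sum_(j < k.+1) q j ^+ n < eta / 2 by near: n; exact: small.
set E := [set w | _].
have mE : measurable E by apply: measurable_Wdist_gt.
pose Low j := [set w | \sum_(i < n) \1_(C j) (X i w) < (1 - del) * fine (nu (C j)) * n%:R].
pose High := [set w | c1 < n%:R^-1 * \sum_(i < n) g (X i w)].
have mLow j : measurable (Low j).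
  rewrite (_ : Low j = (fun w => \sum_(i < n) \1_(C j) (X i w)) @^-1`
      `]-oo, (1 - del) * fine (nu (C j)) * n%:R[).
    rewrite -[X in measurable X]setTI; apply: measurable_sum => // i.
    by apply: measurableT_comp => //; apply: measurable_indic; exact: mcell.
  by apply/seteqP; split => w /=; rewrite in_itv.
have mHigh : measurable High.
  rewrite (_ : High = (fun w => n%:R^-1 * \sum_(i < n) g (X i w)) @^-1` `]c1, +oo[).
    rewrite -[X in measurable X]setTI; apply: measurable_funM => //.
    by apply: measurable_sum => i; apply: measurableT_comp.
  by apply/seteqP; split => w /=; rewrite in_itv/= andbT.
pose Bad := \big[setU/set0]_(j < k.+1) Low j `|` High.
have mBad : measurable Bad by apply: measurableU => //; apply: bigsetU_measurable.
have good : ~` Bad `<=` E.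
  move=> w nBad; rewrite /E /= lt_Wdist//.
  have freq j : (j <= k)%N -> (1 - del) * fine (nu (C j)) * n%:R <=
      \sum_(i < n) (cell (X i w) == j)%:R.
    move=> jk; rewrite leNgt; apply/negP => low; apply: nBad; left.
    rewrite -(bigcup_mkord k.+1 Low); exists j => //=.
    rewrite /Low /= (eq_bigr (fun i : 'I_n => (cell (X i w) == j)%:R))// => i _.
    by rewrite indicE; congr (nat_of_bool _)%:R; apply/idP/eqP; rewrite inE.
  have [sig [sigE sigc]] := @cell_transport _ _ _ _ Hpol p nu x0 k cell p0 cellk mcell
    e D M kap del ME kapE (ltW e0) celle D0 cellD del01 n (fun i => X i w) n0 freq.
  apply: (Hc0 n (fun i => X i w) sig n0 sigE); apply: (le_trans sigc).
  rewrite lee_fin eE.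
  have avg : n%:R^-1 * \sum_(i < n) g (X i w) <= c1.
    by rewrite leNgt; apply/negP => hi; apply: nBad; right.
  rewrite -/K !mulrDr.
  have h1 : K * (2 * (n%:R^-1 * \sum_(i < n) g (X i w))) <= c0 / 4.
    have -> : c0 / 4 = K * (2 * c1) by rewrite /c1; field; rewrite gt_eqF.
    by rewrite ler_pM2l// ler_pM2l.
  have h2 : K * kap <= c0 / 4.
    by rewrite mulrC -ler_pdivlMr// ltW.
  have h3 : K * (del * D) + K * (del * M) <= c0 / 4 by rewrite -!mulrDr.
  move: h1 h2 h3; rewrite /g /G; lra.
have QBad : (Q Bad <= eta%:E)%E.
  apply: (@le_trans _ _ (Q (\big[setU/set0]_(j < k.+1) Low j) + Q High)%E).
    by apply: measureU2 => //; apply: bigsetU_measurable.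
  have -> : eta = eta / 2 + eta / 2 by lra.
  rewrite EFinD; apply: leeD.
    apply: (@le_trans _ _ (\sum_(j < k.+1) Q (Low j))%E).
      by apply: content_subadditive => //; apply: bigsetU_measurable.
    apply: (@le_trans _ _ (\sum_(j < k.+1) (q j ^+ n)%:E)%E).
      apply: lee_sum => j _; have [_ _ H] := Hq j; exact: (H n Q n0 iidQ).
    by rewrite sumEFin lee_fin ltW.
  apply: (@le_trans _ _ (kap / c1)%:E).
    exact: (high_average mX g0 mg kapE).
  by rewrite lee_fin ler_pdivrMr// mulrC ltW.
have QC : (1 - eta%:E <= Q (~` Bad))%E.
  by rewrite probability_setC// leeB.
rewrite -lee_fin fineK ?fin_num_measure// EFinB; apply: (le_trans QC).
by apply: le_measure; rewrite ?inE//; exact: measurableC.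
Unshelve. all: by end_near.
Qed.

End empirical_far.

(** * The lower bound on the exponential rate *)

Lemma limn_einf_ge {R : realType} (u : nat -> \bar R) (a : \bar R) :
  (\forall n \near \oo, (a <= u n)%E) -> (a <= limn_einf u)%E.
Proof.
move=> [N _ HN]; rewrite limn_einf_lim; apply: lime_ge; first exact: is_cvg_einfs.
exists N => // n /= Nn; apply: le_ereal_inf_tmp => _ [m /= nm <-].
by apply: HN => /=; exact: leq_trans nm.
Qed.

Section lower_bound.
Context {R : realType} {d : measure_display} {T : measurableType d}
  (rho : T -> T -> R) (p : R) (mu : probability T R)
  {dO : measure_display} {Omega : measurableType dO} (P : probability Omega R)
  (X : nat -> Omega -> T) (t : R).
Hypotheses (Hpol : polish_borel rho) (p1 : 1 <= p) (iidX : iid_law P X mu) (t0 : 0 < t).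

Let rate n : \bar R :=
  ((n%:R^-1)%:E * lne (P [set w | t%:E < Wdist rho p (empirical X n w) mu]))%E.

Lemma liminf_ge_density (nu : probability T R) (f : T -> R) :
  finite_pmoment rho p nu -> (t%:E < Wdist rho p nu mu)%E -> density_of nu mu f ->
  (- (\int[nu]_x (ln (f x))%:E) <= limn_einf rate)%E.
Proof.
move=> nuP far fdens.
have p0 : 0 < p by rewrite (lt_le_trans ltr01).
have mX i : measurable_fun setT (X i) by case: iidX.
rewrite entropy_integralE.
have := entropy_neg_part_le1 fdens.
set Jm := (\int[nu]_x (Num.max (- ln (f x)) 0)%:E)%E.
set Ip := (\int[nu]_x (Num.max (ln (f x)) 0)%:E)%E.
move=> J1.
have Jm0 : (0 <= Jm)%E by apply: integral_ge0 => x _; rewrite lee_fin le_max lexx orbT.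
have Ip0 : (0 <= Ip)%E by apply: integral_ge0 => x _; rewrite lee_fin le_max lexx orbT.
have JE : Jm = (fine Jm)%:E.
  by rewrite fineK// ge0_fin_numE// (le_lt_trans J1)// ltry.
(* An infinite entropy makes the claimed bound [-oo]. *)
have [Iy|Ifin] := eqVneq Ip +oo%E; first by rewrite Iy JE /= leNye.
have IE : Ip = (fine Ip)%:E by rewrite fineK// ge0_fin_numE// ltey.
move: JE IE; set J := fine Jm; set I := fine Ip => JE IE.
(* Non-negativity of the entropy is the entropy inequality with one variable, the empty event and
   [c = 0]; it makes [H + eps] positive. *)
have HIJ : 0 <= I - J.
  have [Q [_ QE QI]] := change_of_law iidX 1 fdens.
  have := entropy_bound iidX fdens (n := 1%N) QE QI measurable0 (lexx 0) IE JE.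
  by rewrite !measure0 mul0r mulr0 mul1r sub0r oppr_le0.
rewrite IE JE -EFinB [leLHS](_ : _ = (- (I - J))%:E)//.
apply/lee_addgt0Pr => eps eps0.
rewrite -leeBlDr// -EFinB; apply: limn_einf_ge.
set H := I - J.
have Heps : 0 < H + eps by rewrite ltr_wpDl.
(* Chosen so that [n (H + eps) (1 - eta) - n H = n eps / 2], which is at least one for large [n]. *)
pose eta := eps / 2 / (H + eps).
have eta0 : 0 < eta by rewrite !divr_gt0.
near=> n.
have n0 : (0 < n)%N by near: n; exists 1%N.
have nR0 : 0 < n%:R :> R by rewrite ltr0n.
have nbig : 1 <= n%:R * (eps / 2).
  rewrite -ler_pdivrMr ?divr_gt0// div1r; near: n; exact: nbhs_infty_ger.
have farn : forall Q : probability Omega R, iid_upto X nu n Q ->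
    1 - eta <= fine (Q [set w | (t%:E < Wdist rho p (empirical X n w) mu)%E]).
  by near: n; exact: (empirical_far Hpol p0 nuP mX (ltW t0) eta0 far).
have [Q [_ QE QI]] := change_of_law iidX n fdens.
set A := [set w | (t%:E < Wdist rho p (empirical X n w) mu)%E].
have mA : measurable A by apply: measurable_Wdist_gt => //; exact: ltW.
have QA : 1 - eta <= fine (Q A) := farn Q QI.
pose c := n%:R * (H + eps).
have c0 : 0 <= c by rewrite mulr_ge0// ltW.
have := entropy_bound iidX fdens QE QI mA c0 IE JE.
rewrite -/H => low.
have PA : expR (- c) <= fine (P A).
  rewrite expRN -[leLHS]mul1r ler_pdivrMr ?expR_gt0// mulrC; apply: le_trans low.
  apply: (@le_trans _ _ (c * (1 - eta) - n%:R * H)); last first.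
    by rewrite lerD2r ler_wpM2l.
  apply: (le_trans nbig); rewrite /c /eta.
  have -> : n%:R * (H + eps) * (1 - eps / 2 / (H + eps)) - n%:R * H = n%:R * (eps / 2).
    by field; rewrite gt_eqF.
  exact: lexx.
(* Positivity keeps [lne] away from its value [-oo] at zero. *)
have PA0 : 0 < fine (P A) by rewrite (lt_le_trans (expR_gt0 _) PA).
rewrite /rate -/A -[P A]fineK ?fin_num_measure// lne_EFin// -EFinM lee_fin.
rewrite ler_pdivlMl//.
have -> : n%:R * (- H - eps) = - c by rewrite /c; ring.
by rewrite -ler_expR lnK ?posrE.
Unshelve. all: by end_near.
Qed.

End lower_bound.

Unset Implicit Arguments.

Theorem theorem2p2 (R : realType) (d : measure_display) (T : measurableType d)
  (rho : T -> T -> R) (p : R) (mu : probability T R)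
  (dO : measure_display) (Omega : measurableType dO) (P : probability Omega R)
  (X : nat -> Omega -> T) (t : R) :
  polish_borel rho -> 1 <= p -> mu \in Pp rho p ->
  iid_law P X mu -> 0 < t ->
  (- ereal_inf [set rel_entropy nu mu |
                 nu in [set nu | nu \in Pp rho p /\ t%:E < Wdist rho p nu mu]]
   <= limn_einf (fun n : nat =>
        (n%:R^-1)%:E * lne (P [set w | t%:E < Wdist rho p (empirical X n w) mu])))%E.
Proof.
move=> Hpol p1 _ iidX t0; rewrite leeNl.
apply: le_ereal_inf_tmp => _ [nu [nuP far] <-]; rewrite /rel_entropy.
(* Without domination the entropy is [+oo]; otherwise it is an infimum over densities, and each
   density is treated separately. *)
case: ifP => _; last exact: leey.
apply: le_ereal_inf_tmp => _ [f fdens <-]; rewrite leeNl.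
by apply: (liminf_ge_density Hpol p1 iidX t0 _ far fdens); move: nuP; rewrite inE.
Qed.
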